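(* Every consistent completion $T$ of $\mathsf{PA}$ has a countable nonstandard model $\mathcal{M}$ that is not recursively saturated and such that the standard cut $\omega$ is not $\Delta^1_1$-definable in $(\mathcal{M},\mathrm{Def}(\mathcal{M}))$. Moreover, such an $\mathcal{M}$ can be chosen to be finitely generated.
   Context: $\mathsf{PA}$ is first-order Peano arithmetic; a completion of $\mathsf{PA}$ is a complete consistent theory in the language of arithmetic extending $\mathsf{PA}$. $\mathcal{M}$ is recursively saturated if every type $\{\varphi_n(x,\bar a):n<\omega\}$, with $\bar a$ a fixed finite tuple from $M$ and $\langle\varphi_n(x,\bar y)\rangle$ a recursive sequence of formulas, that is finitely realizable in $\mathcal{M}$ is realized in $\mathcal{M}$. $\mathrm{Def}(\mathcal{M})$ is the collection of subsets of $M$ first-order definable in $\mathcal{M}$ with parameters, and $(\mathcal{M},\mathrm{Def}(\mathcal{M}))$ is the model of second-order arithmetic whose set variables range over $\mathrm{Def}(\mathcal{M})$. A subset of $M$ is $\Delta^1_1$-definable there if it is definable (with parameters) both by a formula $\exists X\,\theta(x,X)$ and by a formula $\forall X\,\theta'(x,X)$, where $\theta,\theta'$ have no set quantifiers. $\omega$ denotes the set of standard elements of $\mathcal{M}$. $\mathcal{M}$ is finitely generated if there is a finite tuple $\bar a$ from $M$ such that every element of $M$ is first-order definable in $\mathcal{M}$ from $\bar a$. *)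

(* Defs.v *)
From mathcomp Require Import all_boot.

Set Implicit Arguments.
Unset Strict Implicit.
Unset Printing Implicit Defensive.

Definition scons (A : Type) (x : A) (v : nat -> A) : nat -> A :=
  fun n => if n is m.+1 then v m else x.

(** ** Syntax, with de Bruijn indices for number variables *)

Inductive term : Type :=
  | Var of nat
  | Zero
  | One
  | Add of term & term
  | Mul of term & term.

(* [SV] is the type of set variables; there are no set quantifiers.
   [formula void] is the first-order language of arithmetic {0, 1, +, *, <},
   and [formula nat] is the set-quantifier-free part of the language of
   second-order arithmetic. *)
Inductive formula (SV : Type) : Type :=
  | Eq of term & term
  | Lt of term & term
  | Mem of term & SV
  | Bot
  | Imp of formula SV & formula SV
  | All of formula SV.

Arguments Eq {SV}.
Arguments Lt {SV}.
Arguments Bot {SV}.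

Section Syntax.
Variable SV : Type.
Implicit Types (p q : formula SV).

Definition Neg p := Imp p Bot.
Definition And p q := Neg (Imp p (Neg q)).
Definition Iff p q := And (Imp p q) (Imp q p).
Definition Ex p := Neg (All (Neg p)).

Fixpoint tsubst (s : nat -> term) (t : term) : term :=
  match t with
  | Var n => s n
  | Zero => Zero
  | One => One
  | Add t u => Add (tsubst s t) (tsubst s u)
  | Mul t u => Mul (tsubst s t) (tsubst s u)
  end.

Definition shift (n : nat) : term := Var n.+1.

Definition up (s : nat -> term) : nat -> term :=
  scons (Var 0) (fun n => tsubst shift (s n)).

Fixpoint subst (s : nat -> term) p : formula SV :=
  match p with
  | Eq t u => Eq (tsubst s t) (tsubst s u)
  | Lt t u => Lt (tsubst s t) (tsubst s u)
  | Mem t X => Mem (tsubst s t) X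
  | Bot => Bot
  | Imp p q => Imp (subst s p) (subst s q)
  | All p => All (subst (up s) p)
  end.

Definition inst (t : term) p := subst (scons t Var) p.

Fixpoint tbounded (k : nat) (t : term) : bool :=
  match t with
  | Var n => n < k
  | Zero | One => true
  | Add t u | Mul t u => tbounded k t && tbounded k u
  end.

(* All free number variables of [p] are among [Var 0, ..., Var k.-1]. *)
Fixpoint bounded (k : nat) p : bool :=
  match p with
  | Eq t u | Lt t u => tbounded k t && tbounded k u
  | Mem t _ => tbounded k t
  | Bot => true
  | Imp p q => bounded k p && bounded k q
  | All p => bounded k.+1 p
  end.

Definition sentence p : bool := bounded 0 p.

End Syntax.

Definition fo_formula := formula void.
Definition theory := fo_formula -> Prop.

(** ** Classical natural deduction with equality *)

Inductive deriv : seq fo_formula -> fo_formula -> Prop :=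
  | d_ctx G (i : nat) : i < size G -> deriv G (nth Bot G i)
  | d_impI G p q : deriv (p :: G) q -> deriv G (Imp p q)
  | d_impE G p q : deriv G (Imp p q) -> deriv G p -> deriv G q
  | d_allI G p : deriv (map (subst shift) G) p -> deriv G (All p)
  | d_allE G p t : deriv G (All p) -> deriv G (inst t p)
  | d_dn G p : deriv G (Neg (Neg p)) -> deriv G p
  | d_refl G t : deriv G (Eq t t)
  | d_leibniz G p t u :
      deriv G (Eq t u) -> deriv G (inst t p) -> deriv G (inst u p).

Definition proves (T : theory) (p : fo_formula) : Prop :=
  exists G : seq fo_formula,
    (forall i, i < size G -> T (nth Bot G i)) /\ deriv G p.

Definition consistent (T : theory) : Prop := ~ proves T Bot.

Definition complete (T : theory) : Prop :=
  forall p, sentence p -> proves T p \/ proves T (Neg p).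

(** ** Peano arithmetic *)

Definition induction (p : fo_formula) : fo_formula :=
  Imp (inst Zero p)
    (Imp (All (Imp p (subst (scons (Add (Var 0) One) shift) p)))
       (All p)).

Inductive PA : theory :=
  | PA_succ_neq0 : PA (All (Neg (Eq (Add (Var 0) One) Zero)))
  | PA_succ_inj : PA (All (All (Imp (Eq (Add (Var 1) One) (Add (Var 0) One))
                                    (Eq (Var 1) (Var 0)))))
  | PA_add0 : PA (All (Eq (Add (Var 0) Zero) (Var 0)))
  | PA_addS : PA (All (All (Eq (Add (Var 1) (Add (Var 0) One))
                               (Add (Add (Var 1) (Var 0)) One))))
  | PA_mul0 : PA (All (Eq (Mul (Var 0) Zero) Zero))
  | PA_mulS : PA (All (All (Eq (Mul (Var 1) (Add (Var 0) One))
                               (Add (Mul (Var 1) (Var 0)) (Var 1)))))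
  (* x < y <-> exists z, x + (z + 1) = y *)
  | PA_lt : PA (All (All (Iff (Lt (Var 1) (Var 0))
                 (Ex (Eq (Add (Var 2) (Add (Var 0) One)) (Var 1))))))
  (* universal closures of all instances of induction *)
  | PA_induction n p : sentence (iter n (@All void) (induction p)) ->
                 PA (iter n (@All void) (induction p)).

(* [T] need not be deductively closed. *)
Definition completion_of_PA (T : theory) : Prop :=
  [/\ forall p, T p -> sentence p,
      forall p, PA p -> proves T p,
      consistent T
    & complete T].

(** ** Structures and satisfaction *)

Record structure : Type := Structure {
  carrier :> Type;
  s_zero : carrier;
  s_one : carrier;
  s_add : carrier -> carrier -> carrier;
  s_mul : carrier -> carrier -> carrier;
  s_lt : carrier -> carrier -> Prop }.

Section Semantics.
Variable M : structure.

Fixpoint eval (v : nat -> M) (t : term) : M :=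
  match t with
  | Var n => v n
  | Zero => s_zero M
  | One => s_one M
  | Add t u => s_add (eval v t) (eval v u)
  | Mul t u => s_mul (eval v t) (eval v u)
  end.

Fixpoint sat (SV : Type) (V : SV -> M -> Prop) (v : nat -> M)
    (p : formula SV) : Prop :=
  match p with
  | Eq t u => eval v t = eval v u
  | Lt t u => s_lt (eval v t) (eval v u)
  | Mem t X => V X (eval v t)
  | Bot => False
  | Imp p q => sat V v p -> sat V v q
  | All p => forall x : M, sat V (scons x v) p
  end.

Definition fo_sat (v : nat -> M) (p : fo_formula) : Prop :=
  sat (fun X : void => match X with end) v p.

(* Variable 0 is [x], variable [i.+1] is the [i]-th entry of [a]; the padding
   is irrelevant for formulas bounded by [(size a).+1]. *)
Definition tuple_env (x : M) (a : seq M) : nat -> M := nth (s_zero M) (x :: a).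

Definition model_of (T : theory) : Prop :=
  forall p, T p -> forall v, fo_sat v p.

Definition countable_structure : Prop := exists f : M -> nat, injective f.

Definition standard (x : M) : Prop :=
  exists n : nat, x = iter n (fun y => s_add y (s_one M)) (s_zero M).

Definition nonstandard : Prop := exists x : M, ~ standard x.

Definition definable_from (a : seq M) (b : M) : Prop :=
  exists p : fo_formula, bounded (size a).+1 p /\
    forall x, fo_sat (tuple_env x a) p <-> x = b.

Definition finitely_generated : Prop :=
  exists a : seq M, forall b : M, definable_from a b.

(* Parameters are given by an assignment [v] to all the remaining variables, of
   which a formula mentions only finitely many; likewise for the number
   parameters [v] and set parameters [P] below. *)
Definition Def (X : M -> Prop) : Prop :=
  exists (p : fo_formula) (v : nat -> M),
    forall x, X x <-> fo_sat (scons x v) p.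

(* Definability in the two-sorted structure (M, XX). *)
Definition sigma11 (XX : (M -> Prop) -> Prop) (A : M -> Prop) : Prop :=
  exists (p : formula nat) (v : nat -> M) (P : nat -> M -> Prop),
    (forall i, XX (P i)) /\
    forall x, A x <-> exists X, XX X /\ sat (scons X P) (scons x v) p.

Definition pi11 (XX : (M -> Prop) -> Prop) (A : M -> Prop) : Prop :=
  exists (p : formula nat) (v : nat -> M) (P : nat -> M -> Prop),
    (forall i, XX (P i)) /\
    forall x, A x <-> forall X, XX X -> sat (scons X P) (scons x v) p.

Definition delta11 (XX : (M -> Prop) -> Prop) (A : M -> Prop) : Prop :=
  sigma11 XX A /\ pi11 XX A.

End Semantics.

(** ** Recursive functions and Gödel numbering *)

(* The total recursive functions: the least class containing the basic functions
   and closed under composition, primitive recursion and minimization of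
   functions that have a zero for every value of the other arguments. *)
Inductive recursive : forall k : nat, (k.-tuple nat -> nat) -> Prop :=
  | rec_zero k : @recursive k (fun _ => 0)
  | rec_succ : @recursive 1 (fun v => (thead v).+1)
  | rec_proj k (i : 'I_k) : @recursive k (fun v => tnth v i)
  | rec_comp k m (f : m.-tuple nat -> nat) (g : 'I_m -> k.-tuple nat -> nat) :
      recursive f -> (forall i, recursive (g i)) ->
      @recursive k (fun v => f [tuple g i v | i < m])
  | rec_prim k (f : k.-tuple nat -> nat) (g : k.+2.-tuple nat -> nat) :
      recursive f -> recursive g ->
      @recursive k.+1 (fun v =>
        nat_rect (fun _ => nat) (f [tuple of behead v])
          (fun n r => g [tuple of n :: r :: behead v]) (thead v))
  | rec_mu k (f : k.+1.-tuple nat -> nat) (h : k.-tuple nat -> nat) :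
      recursive f ->
      (forall v, f [tuple of h v :: v] = 0 /\
                 forall m, m < h v -> f [tuple of m :: v] <> 0) ->
      recursive h
  | rec_ext k (f g : k.-tuple nat -> nat) : f =1 g -> recursive f -> recursive g.

Definition cantor_pair (a b : nat) : nat := ((a + b) * (a + b).+1)./2 + b.

Fixpoint tcode (t : term) : nat :=
  match t with
  | Var n => cantor_pair 0 n
  | Zero => cantor_pair 1 0
  | One => cantor_pair 2 0
  | Add t u => cantor_pair 3 (cantor_pair (tcode t) (tcode u))
  | Mul t u => cantor_pair 4 (cantor_pair (tcode t) (tcode u))
  end.

Fixpoint code (p : fo_formula) : nat :=
  match p with
  | Eq t u => cantor_pair 0 (cantor_pair (tcode t) (tcode u))
  | Lt t u => cantor_pair 1 (cantor_pair (tcode t) (tcode u))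
  | Mem _ X => match X with end
  | Bot => cantor_pair 2 0
  | Imp p q => cantor_pair 3 (cantor_pair (code p) (code q))
  | All p => cantor_pair 4 (code p)
  end.

Definition recursive_sequence (phi : nat -> fo_formula) : Prop :=
  @recursive 1 (fun v => code (phi (thead v))).

Definition recursively_saturated (M : structure) : Prop :=
  forall (a : seq M) (phi : nat -> fo_formula),
    (forall n, bounded (size a).+1 (phi n)) ->
    recursive_sequence phi ->
    (forall s : seq nat, exists x : M,
       forall n, n \in s -> fo_sat (tuple_env x a) (phi n)) ->
    exists x : M, forall n, fo_sat (tuple_env x a) (phi n).

(* Main.v *)
(* Let N be a countably saturated model of T (an ultrapower of a Henkin model)
   and w a nonstandard element of N. The model M is the definable closure of w
   and of an element g of N that is generic for the topology whose basic open
   sets are the arithmetic progressions c + dN.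

   A finitely generated model omits the recursive type "x is not defined by q
   from the generators", q ranging over all formulas, so it is not recursively
   saturated.

   If the standard cut were Pi^1_1 in (M, Def(M)), its complement would be a
   union, over all formulas naming a set from g and w, of sets that are
   first-order definable from g and w: F_n(z, g) for n in omega. There are only
   countably many such families (F_n), and g is built by deciding them one by
   one. Suppose that X is somewhere dense, say dense in c + dN, and consists of
   candidates for g. Either {x in X : F_n(k, x)} is somewhere dense for some n
   and some standard k: then shrink X to it, so that F_n(k, g) will hold at a
   standard k. Or, by saturation, there is a nonstandard e < w such that
   {x in X : F_n(e, x)} is nowhere dense in c + dN for all n: then shrink X to
   its intersection with the progression c + de + dwN, and avoid those nowhere
   dense sets. Since e is the residue of (x - c)/d modulo w, it is definable from
   g and w, so e is a nonstandard element of M outside the union of the F_n. *)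

From HB Require Import structures.
From Stdlib Require Import Ring.
From mathcomp Require Import all_boot boolp.
From mathcomp Require filter.
Require Import Defs.

Set Implicit Arguments.
Unset Strict Implicit.
Unset Printing Implicit Defensive.

(** * Countability of the syntax *)

Fixpoint term_tree (t : term) : GenTree.tree nat :=
  match t with
  | Var n => GenTree.Leaf n
  | Zero => GenTree.Node 0 [::]
  | One => GenTree.Node 1 [::]
  | Add t u => GenTree.Node 2 [:: term_tree t; term_tree u]
  | Mul t u => GenTree.Node 3 [:: term_tree t; term_tree u]
  end.

Fixpoint tree_term (x : GenTree.tree nat) : option term :=
  match x with
  | GenTree.Leaf n => Some (Var n)
  | GenTree.Node 0 [::] => Some Zero
  | GenTree.Node 1 [::] => Some One
  | GenTree.Node 2 [:: x; y] =>
      if (tree_term x, tree_term y) is (Some t, Some u) then Some (Add t u)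
      else None
  | GenTree.Node 3 [:: x; y] =>
      if (tree_term x, tree_term y) is (Some t, Some u) then Some (Mul t u)
      else None
  | _ => None
  end.

Lemma term_treeK : pcancel term_tree tree_term.
Proof. by elim=> //= t -> u ->. Qed.

HB.instance Definition _ := Countable.copy term (pcan_type term_treeK).

Section FormulaCountable.
Variable SV : countType.

Fixpoint formula_tree (p : formula SV) : GenTree.tree (term + SV) :=
  match p with
  | Eq t u => GenTree.Node 0 [:: GenTree.Leaf (inl t); GenTree.Leaf (inl u)]
  | Lt t u => GenTree.Node 1 [:: GenTree.Leaf (inl t); GenTree.Leaf (inl u)]
  | Mem t X => GenTree.Node 2 [:: GenTree.Leaf (inl t); GenTree.Leaf (inr X)]
  | Bot => GenTree.Node 3 [::]
  | Imp p q => GenTree.Node 4 [:: formula_tree p; formula_tree q]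
  | All p => GenTree.Node 5 [:: formula_tree p]
  end.

Fixpoint tree_formula (x : GenTree.tree (term + SV)) : option (formula SV) :=
  match x with
  | GenTree.Node 0 [:: GenTree.Leaf (inl t); GenTree.Leaf (inl u)] =>
      Some (Eq t u)
  | GenTree.Node 1 [:: GenTree.Leaf (inl t); GenTree.Leaf (inl u)] =>
      Some (Lt t u)
  | GenTree.Node 2 [:: GenTree.Leaf (inl t); GenTree.Leaf (inr X)] =>
      Some (Mem t X)
  | GenTree.Node 3 [::] => Some Bot
  | GenTree.Node 4 [:: x; y] =>
      if (tree_formula x, tree_formula y) is (Some p, Some q)
      then Some (Imp p q) else None
  | GenTree.Node 5 [:: x] =>
      if tree_formula x is Some p then Some (All p) else None
  | _ => None
  end.

Lemma formula_treeK : pcancel formula_tree tree_formula.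
Proof. by elim=> //= [p -> q -> | p ->]. Qed.

End FormulaCountable.

HB.instance Definition _ (SV : countType) :=
  Countable.copy (formula SV) (pcan_type (@formula_treeK SV)).

Definition nth_of (A : countType) (a : A) (n : nat) : A := odflt a (unpickle n).

Lemma nth_of_surj (A : countType) (a b : A) : exists n, nth_of a n = b.
Proof. by exists (pickle b); rewrite /nth_of pickleK. Qed.

(** * Substitution and boundedness *)

Lemma tsubst_comp s s' t :
  tsubst s (tsubst s' t) = tsubst (fun n => tsubst s (s' n)) t.
Proof. by elim: t => //= t -> u ->. Qed.

Lemma tsubst_id t : tsubst Var t = t.
Proof. by elim: t => //= t -> u ->. Qed.

Lemma up_comp s s' :
  (fun n => tsubst (up s) (up s' n)) = up (fun n => tsubst s (s' n)).
Proof. by apply/funext => -[|n] //=; rewrite !tsubst_comp. Qed.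

Lemma up_Var : up Var = Var.
Proof. by apply/funext; case. Qed.

Section SubstitutionLemmas.
Variable SV : Type.
Implicit Types p : formula SV.

Lemma subst_comp s s' p :
  subst s (subst s' p) = subst (fun n => tsubst s (s' n)) p.
Proof.
elim: p s s' => //= [t u|t u|t X|p IHp q IHq|p IHp] s s';
  rewrite ?tsubst_comp ?IHp ?IHq //.
by rewrite up_comp.
Qed.

Lemma subst_id p : subst Var p = p.
Proof.
elim: p => //= [t u|t u|t X|p -> q ->|p IHp] //; rewrite ?tsubst_id //.
by rewrite up_Var IHp.
Qed.

Lemma tbounded_mono k k' t : k <= k' -> tbounded k t -> tbounded k' t.
Proof.
move=> kk'; elim: t => //= [n nk|t IHt u IHu|t IHt u IHu].
- exact: leq_trans nk kk'.
- by case/andP=> /IHt-> /IHu->.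
- by case/andP=> /IHt-> /IHu->.
Qed.

Lemma bounded_mono k k' p : k <= k' -> bounded k p -> bounded k' p.
Proof.
elim: p k k' => //= [t u|t u|t X|p IHp q IHq|p IHp] k k' kk'.
- by case/andP; do 2 move/(tbounded_mono kk')=> ->.
- by case/andP; do 2 move/(tbounded_mono kk')=> ->.
- exact: tbounded_mono.
- by case/andP=> /(IHp _ _ kk')-> /(IHq _ _ kk')->.
- exact: IHp.
Qed.

Lemma tbounded_ex t : exists k, tbounded k t.
Proof.
elim: t => /= [n|||t [k tk] u [l ul]|t [k tk] u [l ul]].
- by exists n.+1.
- by exists 0.
- by exists 0.
- by exists (maxn k l); rewrite !(tbounded_mono _ tk, tbounded_mono _ ul)
    ?leq_maxl ?leq_maxr.
- by exists (maxn k l); rewrite !(tbounded_mono _ tk, tbounded_mono _ ul)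
    ?leq_maxl ?leq_maxr.
Qed.

Lemma bounded_ex p : exists k, bounded k p.
Proof.
elim: p => /= [t u|t u|t X||p [k pk] q [l ql]|p [k pk]].
- have [k tk] := tbounded_ex (Add t u); by exists k.
- have [k tk] := tbounded_ex (Add t u); by exists k.
- exact: tbounded_ex.
- by exists 0.
- by exists (maxn k l); rewrite !(bounded_mono _ pk, bounded_mono _ ql)
    ?leq_maxl ?leq_maxr.
- by exists k; apply: bounded_mono pk.
Qed.

Lemma tbounded_subst k k' s t : tbounded k t ->
  (forall n, n < k -> tbounded k' (s n)) -> tbounded k' (tsubst s t).
Proof.
move=> + sk; elim: t => //= t IHt u IHu.
- by case/andP=> /IHt-> /IHu->.
- by case/andP=> /IHt-> /IHu->.
Qed.

Lemma bounded_subst k k' s p : bounded k p ->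
  (forall n, n < k -> tbounded k' (s n)) -> bounded k' (subst s p).
Proof.
elim: p k k' s => //= [t u|t u|t X|p IHp q IHq|p IHp] k k' s.
- by case/andP=> tk uk sk; rewrite (tbounded_subst tk sk) (tbounded_subst uk sk).
- by case/andP=> tk uk sk; rewrite (tbounded_subst tk sk) (tbounded_subst uk sk).
- by move=> tk sk; rewrite (tbounded_subst tk).
- by case/andP=> pk qk sk; rewrite (IHp _ _ _ pk sk) (IHq _ _ _ qk sk).
- move=> pk sk; apply: IHp pk _ => -[|n] //= nk.
  by apply: tbounded_subst (sk _ nk) _ => m.
Qed.

Lemma tsubst_bounded k s s' t : tbounded k t ->
  (forall n, n < k -> s n = s' n) -> tsubst s t = tsubst s' t.
Proof.
move=> + sk; elim: t => //= t IHt u IHu.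
- by case/andP=> /IHt-> /IHu->.
- by case/andP=> /IHt-> /IHu->.
Qed.

Lemma subst_bounded k s s' p : bounded k p ->
  (forall n, n < k -> s n = s' n) -> subst s p = subst s' p.
Proof.
elim: p k s s' => //= [t u|t u|t X|p IHp q IHq|p IHp] k s s'.
- by case/andP=> tk uk sk; rewrite (tsubst_bounded tk sk) (tsubst_bounded uk sk).
- by case/andP=> tk uk sk; rewrite (tsubst_bounded tk sk) (tsubst_bounded uk sk).
- by move=> tk sk; rewrite (tsubst_bounded tk sk).
- by case/andP=> pk qk sk; rewrite (IHp _ _ _ pk sk) (IHq _ _ _ qk sk).
- by move=> pk sk; rewrite (IHp _ _ (up s') pk) // => -[|n] //= /sk ->.
Qed.

Lemma inst_subst s t p :
  inst (tsubst s t) (subst (up s) p) = subst s (inst t p).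
Proof.
rewrite /inst !subst_comp; congr subst; apply/funext => -[|n] //=.
by rewrite tsubst_comp; apply: tsubst_id.
Qed.

Lemma inst_up s t p : inst t (subst (up s) p) = subst (scons t s) p.
Proof.
rewrite /inst subst_comp; congr subst; apply/funext => -[|n] //=.
by rewrite tsubst_comp; apply: tsubst_id.
Qed.

Section Sat.
Variable M : structure.
Implicit Types (V : SV -> M -> Prop) (v : nat -> M).

Lemma eval_subst v s t : eval v (tsubst s t) = eval (fun n => eval v (s n)) t.
Proof. by elim: t => //= t -> u ->. Qed.

Lemma scons_eta (A : Type) (v : nat -> A) :
  v = scons (v 0) (fun n => v n.+1).
Proof. by apply/funext; case. Qed.

Lemma sat_subst V v s p :
  sat V v (subst s p) = sat V (fun n => eval v (s n)) p.
Proof.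
elim: p v s => //= [t u|t u|t X|p IHp q IHq|p IHp] v s;
  rewrite ?eval_subst ?IHp ?IHq //.
rewrite propeqE; split=> H x; have := H x; rewrite IHp;
  by congr sat; apply/funext => -[|n] //=; rewrite eval_subst.
Qed.

Lemma eval_bounded k v v' t : tbounded k t ->
  (forall n, n < k -> v n = v' n) -> eval v t = eval v' t.
Proof.
move=> + vk; elim: t => //= t IHt u IHu.
- by case/andP=> /IHt-> /IHu->.
- by case/andP=> /IHt-> /IHu->.
Qed.

Lemma sat_bounded k V v v' p : bounded k p ->
  (forall n, n < k -> v n = v' n) -> sat V v p = sat V v' p.
Proof.
elim: p k v v' => //= [t u|t u|t X|p IHp q IHq|p IHp] k v v'.
- by case/andP=> tk uk vk; rewrite (eval_bounded tk vk) (eval_bounded uk vk).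
- by case/andP=> tk uk vk; rewrite (eval_bounded tk vk) (eval_bounded uk vk).
- by move=> tk vk; rewrite (eval_bounded tk vk).
- by case/andP=> pk qk vk; rewrite (IHp _ _ _ pk vk) (IHq _ _ _ qk vk).
- move=> pk vk; rewrite propeqE; split=> H x; have := H x;
  by rewrite (IHp _ _ (scons x v') pk) // => -[|n] //= /vk ->.
Qed.

Lemma sat_sentence V v v' p : sentence p -> sat V v p = sat V v' p.
Proof. by move=> sp; apply: sat_bounded sp _. Qed.

End Sat.
End SubstitutionLemmas.

(** * Henkin's completeness theorem *)

Lemma deriv_hyp (G : seq fo_formula) p : p \in G -> deriv G p.
Proof.
by move=> pG; rewrite -(nth_index Bot pG); apply: d_ctx; rewrite index_mem.
Qed.

Lemma deriv_weaken (G G' : seq fo_formula) p :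
  {subset G <= G'} -> deriv G p -> deriv G' p.
Proof.
move=> sGG' Gp; elim: Gp G' sGG' => {G p}.
- by move=> G i iG G' sGG'; apply/deriv_hyp/sGG'/mem_nth.
- move=> G p q _ IH G' sGG'; apply/d_impI/IH => r.
  by rewrite !inE => /orP[->//|/sGG'->]; rewrite orbT.
- by move=> G p q _ IHp _ IHq G' sGG'; apply: d_impE (IHp _ sGG') (IHq _ sGG').
- move=> G p _ IH G' sGG'; apply/d_allI/IH => r /mapP[q qG ->].
  by apply: map_f; apply: sGG'.
- by move=> G p t _ IH G' sGG'; apply/d_allE/IH.
- by move=> G p _ IH G' sGG'; apply/d_dn/IH.
- by move=> G t G' _; apply: d_refl.
- by move=> G p t u _ IH1 _ IH2 G' sGG'; apply: d_leibniz (IH1 _ sGG') (IH2 _ sGG').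
Qed.

Lemma deriv_subst (G : seq fo_formula) p s :
  deriv G p -> deriv (map (subst s) G) (subst s p).
Proof.
move=> Gp; elim: Gp s => {G p}.
- by move=> G i iG s; apply/deriv_hyp/map_f/mem_nth.
- by move=> G p q _ IH s; apply/d_impI/IH.
- by move=> G p q _ IHp _ IHq s; apply: d_impE (IHp s) (IHq s).
- move=> G p _ IH s; apply: d_allI; have := IH (up s); rewrite -!map_comp.
  by congr deriv; apply: eq_map => q /=; rewrite !subst_comp.
- by move=> G p t _ IH s; rewrite -inst_subst; apply: d_allE (IH s).
- by move=> G p _ IH s; apply: d_dn (IH s).
- by move=> G t s; apply: d_refl.
- move=> G p t u _ IH1 _ IH2 s; rewrite -inst_subst.
  by apply: d_leibniz (IH1 s) _; rewrite inst_subst.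
Qed.

Definition add_axiom (T : theory) (p : fo_formula) : theory :=
  fun q => T q \/ q = p.

Lemma provesP T p :
  proves T p <-> exists2 G, (forall q, q \in G -> T q) & deriv G p.
Proof.
split=> [[G [TG Gp]]|[G TG Gp]]; exists G => //.
  by move=> q qG; rewrite -(nth_index Bot qG); apply: TG; rewrite index_mem.
by split=> // i iG; apply/TG/mem_nth.
Qed.

Lemma proves_axiom (T : theory) p : T p -> proves T p.
Proof.
move=> Tp; apply/provesP; exists [:: p]; last exact/deriv_hyp/mem_head.
by move=> q; rewrite inE => /eqP->.
Qed.

Lemma proves_mono (T T' : theory) p :
  (forall q, T q -> T' q) -> proves T p -> proves T' p.
Proof. by move=> TT' /provesP[G GT Gp]; apply/provesP; exists G; auto. Qed.

(** Cut: the hypotheses in [G] are discharged one at a time by [d_impI], and each is then supplied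
    by its own proof from [T]. *)
Lemma proves_deriv (T : theory) G p :
  (forall q, q \in G -> proves T q) -> deriv G p -> proves T p.
Proof.
elim: G p => [|r G IH] p TG Gp; first by apply/provesP; exists [::].
have /IH/provesP[|G1 TG1 G1p]: deriv G (Imp r p) by apply: d_impI.
  by move=> q qG; apply: TG; rewrite inE qG orbT.
have /provesP[G2 TG2 G2r]: proves T r by apply: TG; rewrite mem_head.
apply/provesP; exists (G1 ++ G2).
  by move=> q; rewrite mem_cat => /orP[/TG1|/TG2].
apply: (@d_impE _ r).
  by apply: deriv_weaken G1p => q; rewrite mem_cat => ->.
by apply: deriv_weaken G2r => q; rewrite mem_cat orbC => ->.
Qed.

Lemma proves_imp T p q : proves (add_axiom T p) q -> proves T (Imp p q).
Proof.
move=> /provesP[G TG Gq]; apply/provesP; exists [seq r <- G | r != p].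
  by move=> r; rewrite mem_filter => /andP[/eqP rp /TG[]].
apply: d_impI; apply: deriv_weaken Gq => r rG.
by rewrite inE mem_filter rG andbT; case: eqP.
Qed.

(** Meant for a refuted Henkin axiom, which thus yields both the instance at the fresh variable and
    the negated generalization. *)
Lemma deriv_neg_imp (p q : fo_formula) :
  deriv [:: Neg (Imp p q)] p /\ deriv [:: Neg (Imp p q)] (Neg q).
Proof.
split; last first.
  apply: d_impI; apply: (@d_impE _ (Imp p q)).
    by apply: deriv_hyp; rewrite !inE eqxx orbT.
  by apply: d_impI; apply: deriv_hyp; rewrite !inE eqxx orbT.
apply: d_dn; apply: d_impI; apply: (@d_impE _ (Imp p q)).
  by apply: deriv_hyp; rewrite !inE eqxx orbT.
apply/d_impI/d_dn/d_impI; apply: (@d_impE _ p); apply: deriv_hyp;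
  by rewrite !inE eqxx ?orbT.
Qed.

Definition henkin_axiom (z : nat) (p : fo_formula) := Imp (inst (Var z) p) (All p).

(** If the axiom were refutable, [T] would prove [inst (Var k) p] and [Neg (All p)]. The variable
    [k] is free neither in [T] nor in [p], so the first proof generalizes to [All p]. *)
Lemma consistent_henkin (T : theory) k p :
  (forall q, T q -> bounded k q) -> bounded k p -> consistent T ->
  consistent (add_axiom T (henkin_axiom k p)).
Proof.
move=> Tk pk Tcons /proves_imp Th; have [d1 d2] := deriv_neg_imp (inst (Var k) p) (All p).
have Th1 q : q \in [:: Neg (henkin_axiom k p)] -> proves T q.
  by rewrite inE => /eqP->.
have /provesP[G TG Gp] := proves_deriv Th1 d1.
apply: Tcons; apply: (proves_deriv (G := [:: Neg (All p); All p])); last first.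
  by apply: (@d_impE _ (All p)); apply: deriv_hyp; rewrite !inE eqxx ?orbT.
move=> q; rewrite !inE => /orP[|] /eqP->; first exact: proves_deriv Th1 d2.
apply/provesP; exists G => //; apply: d_allI.
(* On formulas with variables below [k] this renaming agrees with [shift], while it sends [Var k] to
   the variable about to be bound. Hence it turns [inst (Var k) p] back into [p]. *)
pose s n := if n == k then Var 0 else Var n.+1.
have := deriv_subst s Gp; congr deriv.
  apply/eq_in_map => r /TG /Tk rk; apply: subst_bounded rk _ => n nk.
  by rewrite /s ltn_eqF.
rewrite /inst subst_comp -[RHS]subst_id; apply: subst_bounded pk _ => -[|n] /= nk.
  by rewrite /s eqxx.
by rewrite /s ltn_eqF // ltnW.
Qed.

Section Henkin.
Variable T : theory.
Hypothesis T_sentence : forall p, T p -> sentence p.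
Hypothesis T_consistent : consistent T.

Definition bound_of (p : fo_formula) : nat := xchoose (bounded_ex p).

Lemma bound_ofP p : bounded (bound_of p) p.
Proof. exact: xchooseP (bounded_ex p). Qed.

(* The stage records a theory and a bound on the free variables of its axioms;
   the variable at that bound serves as a Henkin constant. *)
Definition henkin_step (p : fo_formula) (S : theory * nat) : theory * nat :=
  let k := maxn S.2 (bound_of p) in
  let T1 := if `[< consistent (add_axiom S.1 p) >] then add_axiom S.1 p
            else S.1 in
  (add_axiom T1 (henkin_axiom k p), k.+1).

Fixpoint henkin_stage (n : nat) : theory * nat :=
  if n is m.+1 then henkin_step (nth_of Bot m) (henkin_stage m) else (T, 0).

Lemma henkin_stageP n :
  (forall p, (henkin_stage n).1 p -> bounded (henkin_stage n).2 p) /\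
  consistent (henkin_stage n).1.
Proof.
elim: n => [|n [bn cn]]; first by split=> // p /T_sentence.
rewrite /=; move: (nth_of Bot n) (henkin_stage n) bn cn => p [S k] /= bn cn.
rewrite /henkin_step /=; set k' := maxn k _; set T1 := if _ then _ else _.
have pk' : bounded k' p by apply: bounded_mono (bound_ofP p); apply: leq_maxr.
have T1k q : T1 q -> bounded k' q.
  rewrite /T1; case: ifP => _; last by move=> /bn; apply: bounded_mono; apply: leq_maxl.
  by case=> [/bn|->//]; apply: bounded_mono; apply: leq_maxl.
have T1c : consistent T1 by rewrite /T1; case: ifP => [/asboolP|].
split; last exact: consistent_henkin.
move=> q [/T1k|->]; first exact: bounded_mono.
rewrite /henkin_axiom /= (bounded_mono _ pk') ?ltnS ?(leqW (leqnSn _)) // andbT.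
apply: bounded_subst pk' _ => -[|m] //= mk; by rewrite ltnW // ltnS ltnW.
Qed.

Lemma henkin_stage_mono m n p :
  m <= n -> (henkin_stage m).1 p -> (henkin_stage n).1 p.
Proof.
move=> /subnK <-; elim: (n - m) => [//|k IH] /IH; rewrite addSn /=.
move: (nth_of Bot _) (henkin_stage _) => q [S l] /= Sp.
by left; case: ifP => // _; left.
Qed.

Definition henkin_theory (p : fo_formula) : Prop :=
  exists n, proves (henkin_stage n).1 p.

Lemma henkin_deriv G p :
  (forall q, q \in G -> henkin_theory q) -> deriv G p -> henkin_theory p.
Proof.
move=> HG Gp.
suff [n Hn] : exists n, forall q, q \in G -> proves (henkin_stage n).1 q.
  by exists n; apply: proves_deriv Hn Gp.
elim: G HG {Gp} => [|r G IH] HG; first by exists 0.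
have [m Hm] := HG r (mem_head _ _).
have [|n Hn] := IH; first by move=> q qG; apply: HG; rewrite inE qG orbT.
exists (maxn m n) => q; rewrite inE => /orP[/eqP->|/Hn Pq].
  by apply: proves_mono Hm => q'; apply: henkin_stage_mono; apply: leq_maxl.
by apply: proves_mono Pq => q'; apply: henkin_stage_mono; apply: leq_maxr.
Qed.

Lemma henkin_consistent : ~ henkin_theory Bot.
Proof. by case=> n; apply: (henkin_stageP n).2. Qed.

Lemma henkin_T p : proves T p -> henkin_theory p.
Proof. by exists 0. Qed.

Lemma henkin_witness p :
  exists z, henkin_theory (Imp (inst (Var z) p) (All p)).
Proof.
have [n <-] := nth_of_surj Bot p.
eexists; exists n.+1; apply: proves_axiom; right; reflexivity.
Qed.

Lemma henkin_complete p : henkin_theory p \/ henkin_theory (Neg p).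
Proof.
have [n np] := nth_of_surj Bot p.
have [cp|ncp] := pselect (consistent (add_axiom (henkin_stage n).1 p)).
  left; exists n.+1; apply: proves_axiom; left; rewrite np.
  by case: asboolP => // _; right.
right; exists n; apply: proves_imp; exact: contrapT.
Qed.

Lemma henkin_impP p q :
  henkin_theory (Imp p q) <-> (henkin_theory p -> henkin_theory q).
Proof.
split=> [Hpq Hp|Hpq].
  apply: (@henkin_deriv [:: Imp p q; p]).
    by move=> r; rewrite !inE => /orP[] /eqP->.
  by apply: (@d_impE _ p); apply: deriv_hyp; rewrite !inE eqxx ?orbT.
have [/Hpq Hq|Hnp] := henkin_complete p.
  apply: (@henkin_deriv [:: q]); first by move=> r; rewrite !inE => /eqP->.
  by apply: d_impI; apply: deriv_hyp; rewrite !inE eqxx orbT.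
apply: (@henkin_deriv [:: Neg p]); first by move=> r; rewrite !inE => /eqP->.
apply/d_impI/d_dn/d_impI; apply: (@d_impE _ p); apply: deriv_hyp;
  by rewrite !inE eqxx ?orbT.
Qed.

Lemma henkin_allP p :
  henkin_theory (All p) <-> forall t, henkin_theory (inst t p).
Proof.
split=> [Hp t|Hp].
  apply: (@henkin_deriv [:: All p]); first by move=> r; rewrite !inE => /eqP->.
  by apply/d_allE/deriv_hyp/mem_head.
by have [z /henkin_impP] := henkin_witness p; apply.
Qed.

Lemma henkin_leibniz p t u :
  henkin_theory (Eq t u) -> henkin_theory (inst t p) -> henkin_theory (inst u p).
Proof.
move=> Htu Ht; apply: (@henkin_deriv [:: Eq t u; inst t p]).
  by move=> r; rewrite !inE => /orP[] /eqP->.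
by apply: (@d_leibniz _ p t); apply: deriv_hyp; rewrite !inE eqxx ?orbT.
Qed.

Lemma henkin_eq_refl t : henkin_theory (Eq t t).
Proof. by apply: (@henkin_deriv [::]) => //; apply: d_refl. Qed.

Lemma inst_shift t u : tsubst (scons t Var) (tsubst shift u) = u.
Proof. by rewrite tsubst_comp; apply: tsubst_id. Qed.

Lemma henkin_eq_sym t u : henkin_theory (Eq t u) -> henkin_theory (Eq u t).
Proof.
move=> tu; have := @henkin_leibniz (Eq (Var 0) (tsubst shift t)) t u tu.
by rewrite /inst /= !inst_shift; apply; apply: henkin_eq_refl.
Qed.

Lemma henkin_eq_trans t u r :
  henkin_theory (Eq t u) -> henkin_theory (Eq u r) -> henkin_theory (Eq t r).
Proof.
move=> tu ur; have := @henkin_leibniz (Eq (tsubst shift t) (Var 0)) u r ur.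
by rewrite /inst /= !inst_shift; apply.
Qed.

Lemma henkin_lt t t' u u' :
  henkin_theory (Eq t t') -> henkin_theory (Eq u u') ->
  henkin_theory (Lt t u) -> henkin_theory (Lt t' u').
Proof.
move=> tt' uu' ltu.
have := @henkin_leibniz (Lt (Var 0) (tsubst shift u)) t t' tt'.
rewrite /inst /= !inst_shift => /(_ ltu) lt'u.
have := @henkin_leibniz (Lt (tsubst shift t') (Var 0)) u u' uu'.
by rewrite /inst /= !inst_shift => /(_ lt'u).
Qed.

End Henkin.

(** * Quotients of structures *)

Section Quotient.
Variables (S : structure) (E : S -> S -> Prop).
Hypothesis Erefl : forall a, E a a.
Hypothesis Esym : forall a b, E a b -> E b a.
Hypothesis Etrans : forall a b c, E a b -> E b c -> E a c.
Hypothesis Eadd : forall a a' b b', E a a' -> E b b' ->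
  E (s_add a b) (s_add a' b').
Hypothesis Emul : forall a a' b b', E a a' -> E b b' ->
  E (s_mul a b) (s_mul a' b').
Hypothesis Elt : forall a a' b b', E a a' -> E b b' ->
  s_lt a b -> s_lt a' b'.

(** Since [sat] reads [Eq] as equality of elements, provable or almost-everywhere equality has to
    become genuine equality. Classes are predicates, identified by extensionality. *)
Definition quotient := {P : S -> Prop | exists a, P = E a}.

Definition pi_quot (a : S) : quotient := exist _ (E a) (ex_intro _ a erefl).

Definition repr_quot (q : quotient) : S := projT1 (cid (proj2_sig q)).

Lemma repr_quotK q : pi_quot (repr_quot q) = q.
Proof.
case: q => P ex; rewrite /repr_quot /=; case: cid => a /= eP.
by apply: eq_exist; rewrite eP.
Qed.

Lemma pi_quotP a b : pi_quot a = pi_quot b <-> E a b.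
Proof.
split=> [[Eab]|Eab]; first by rewrite Eab.
apply: eq_exist; apply/funext => c; rewrite propeqE; split=> Ec.
  exact: Etrans (Esym Eab) Ec.
exact: Etrans Eab Ec.
Qed.

Lemma repr_pi a : E (repr_quot (pi_quot a)) a.
Proof. by apply/pi_quotP; rewrite repr_quotK. Qed.

Definition quotient_structure : structure :=
  @Structure quotient (pi_quot (s_zero S)) (pi_quot (s_one S))
    (fun x y => pi_quot (s_add (repr_quot x) (repr_quot y)))
    (fun x y => pi_quot (s_mul (repr_quot x) (repr_quot y)))
    (fun x y => s_lt (repr_quot x) (repr_quot y)).

Lemma eval_quotient (v : nat -> S) t :
  eval (M := quotient_structure) (fun n => pi_quot (v n)) t = pi_quot (eval v t).
Proof.
elim: t => //= t -> u ->; apply/pi_quotP.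
- by apply: Eadd; apply: repr_pi.
- by apply: Emul; apply: repr_pi.
Qed.

Lemma lt_quotient a b :
  s_lt (pi_quot a : quotient_structure) (pi_quot b) <-> s_lt a b.
Proof.
split; apply: Elt; try exact: repr_pi.
- exact: Esym (repr_pi a).
- exact: Esym (repr_pi b).
Qed.

Lemma scons_pi_quot (q : quotient) (v : nat -> S) :
  scons q (fun n => pi_quot (v n)) =
  fun n => pi_quot (scons (repr_quot q) v n).
Proof. by apply/funext; case=> //=; rewrite repr_quotK. Qed.

End Quotient.

Definition term_structure (lt : term -> term -> Prop) : structure :=
  Structure Zero One Add Mul lt.

Lemma eval_term_structure lt (s : nat -> term) t :
  eval (M := term_structure lt) s t = tsubst s t.
Proof. by elim: t => //= t -> u ->. Qed.

(** The model consists of all terms, open ones included, modulo equality in the Henkin theory; the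
    variables are the Henkin constants. The truth lemma [satK] holds for every assignment of classes
    of terms, which is what its quantifier case needs. *)
Theorem completeness (T : theory) :
  (forall p, T p -> sentence p) -> consistent T ->
  exists K : structure, forall p, sentence p -> proves T p ->
    forall v : nat -> K, fo_sat v p.
Proof.
move=> Ts Tc; pose H := henkin_theory T.
pose S := term_structure (fun t u => H (Lt t u)).
pose E t u := H (Eq t u); pose K := @quotient_structure S E.
have Er := @henkin_eq_refl T; have Es := @henkin_eq_sym T.
have Et := @henkin_eq_trans T.
have cong2 (f : term -> term -> term) :
    (forall s a b, tsubst s (f a b) = f (tsubst s a) (tsubst s b)) ->
    forall a a' b b', E a a' -> E b b' -> E (f a b) (f a' b').
  move=> fs a a' b b' aa' bb'.
  have := @henkin_leibniz T (Eq (tsubst shift (f a b)) (f (Var 0) (tsubst shift b))) a a' aa'.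
  rewrite /inst /= !fs /= !inst_shift => /(_ (Er _)) h1.
  have := @henkin_leibniz T (Eq (tsubst shift (f a b)) (f (tsubst shift a') (Var 0))) b b' bb'.
  by rewrite /inst /= !fs /= !inst_shift => /(_ h1).
have satK p : forall s, @fo_sat K (fun n => pi_quot (S := S) E (s n)) p <-> H (subst s p).
  have ev s t : @eval K (fun n => pi_quot (S := S) E (s n)) t = pi_quot (S := S) E (tsubst s t).
    rewrite eval_quotient ?eval_term_structure //; exact: cong2.
  rewrite /fo_sat; elim: p => //= [t u|t u||p IHp q IHq|p IHp] s.
  - by rewrite !ev; apply: pi_quotP.
  - rewrite !ev; apply: (@lt_quotient S E) => // a a' b b' aa' bb'.
    exact: henkin_lt.
  - by split=> // /(henkin_consistent Ts Tc).
  - rewrite IHp IHq; exact: iff_sym (henkin_impP _ _ _).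
  - split=> [Hp|/henkin_allP Hp q].
      apply/henkin_allP => t; rewrite inst_up; apply/IHp.
      have := Hp (pi_quot (S := S) E t); congr sat.
      by apply/funext; case.
    have := Hp (repr_quot q); rewrite inst_up => /IHp; congr sat.
    by apply/funext => -[|n] //=; apply: repr_quotK.
exists K => p sp Tp v; rewrite /fo_sat.
rewrite (sat_sentence (M := K) _ _ (fun n => pi_quot (S := S) E (Var n)) sp).
apply/satK; rewrite subst_id; exact: henkin_T.
Qed.

(** * Countably saturated ultrapowers *)

Definition countably_saturated (M : structure) : Prop :=
  forall Y : nat -> M -> Prop, (forall n, Def (Y n)) ->
    (forall n, exists x, forall i, i < n -> Y i x) ->
    exists x, forall n, Y n x.

(** An ultrafilter extending the filter of cofinite sets of indices. *)
Lemma nonprincipal_ultrafilter :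
  exists U : (nat -> Prop) -> Prop,
  [/\ forall P Q : nat -> Prop, (forall j, P j -> Q j) -> U P -> U Q,
      forall P Q, U P -> U Q -> U (fun j => P j /\ Q j),
      forall P, U P \/ U (fun j => ~ P j),
      ~ U (fun _ => False)
    & forall n, U (fun j => n <= j)].
Proof.
have [U [Uu sU]] := filter.ultraFilterLemma filter.eventually_filter.
exists U; split.
- by move=> P Q; apply: filter.filterS.
- by move=> P Q; apply: filter.filterI.
- by move=> P; apply: filter.in_ultra_setVsetC.
- exact: filter.filter_not_empty.
- by move=> n; apply: sU; exists n.
Qed.

Section Ultrapower.
Variables (K : structure) (U : (nat -> Prop) -> Prop).
Hypothesis US : forall P Q : nat -> Prop, (forall j, P j -> Q j) -> U P -> U Q.
Hypothesis UI : forall P Q, U P -> U Q -> U (fun j => P j /\ Q j).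
Hypothesis UC : forall P, U P \/ U (fun j => ~ P j).
Hypothesis UF : ~ U (fun _ => False).
Hypothesis Uoo : forall n, U (fun j => n <= j).

Lemma ultra_all P : (forall j, P j) -> U P.
Proof. by move=> HP; apply: US (Uoo 0). Qed.

Lemma ultra_imp P Q : (U P -> U Q) <-> U (fun j => P j -> Q j).
Proof.
split=> [PQ|UPQ UP]; last by apply: US (UI UPQ UP) => j [].
case: (UC P) => [/PQ|]; apply: US => j //.
Qed.

Lemma ultra_forall_lt n (P : nat -> nat -> Prop) :
  (forall i, i < n -> U (P i)) -> U (fun j => forall i, i < n -> P i j).
Proof.
elim: n => [|n IH] HP; first by apply: ultra_all.
have U1 : U (fun j => forall i, i < n -> P i j).
  by apply: IH => i ni; apply: HP; apply: ltnW.
apply: US (UI U1 (HP n (ltnSn n))) => j [H1 H2] i.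
by rewrite ltnS leq_eqVlt => /orP[/eqP->|/H1].
Qed.

(** The order is already taken modulo [U], which makes it invariant under [ultra_eq]; equality is
    taken modulo [U] only by the quotient. *)
Definition power_structure : structure :=
  @Structure (nat -> K) (fun _ => s_zero K) (fun _ => s_one K)
    (fun f g j => s_add (f j) (g j)) (fun f g j => s_mul (f j) (g j))
    (fun f g => U (fun j => s_lt (f j) (g j))).

Definition ultra_eq (f g : power_structure) : Prop := U (fun j => f j = g j).

Definition ultrapower : structure := quotient_structure ultra_eq.

Lemma ultra_eq_refl f : ultra_eq f f.
Proof. exact: ultra_all. Qed.

Lemma ultra_eq_sym f g : ultra_eq f g -> ultra_eq g f.
Proof. by apply: US. Qed.

Lemma ultra_eq_trans f g h : ultra_eq f g -> ultra_eq g h -> ultra_eq f h.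
Proof. by move=> fg gh; apply: US (UI fg gh) => j [->]. Qed.

Lemma eval_power (v : nat -> power_structure) t j :
  eval v t j = eval (fun n => v n j) t.
Proof. by elim: t => //= t -> u ->. Qed.

Lemma los (v : nat -> power_structure) p :
  @fo_sat ultrapower (fun n => pi_quot ultra_eq (v n)) p <->
  U (fun j => fo_sat (fun n => v n j) p).
Proof.
have ev w t : @eval ultrapower (fun n => pi_quot ultra_eq (w n)) t =
              pi_quot ultra_eq (eval w t).
  apply: eval_quotient => [|||f f' g g' ff' gg'|f f' g g' ff' gg'].
  - exact: ultra_eq_refl.
  - exact: ultra_eq_sym.
  - exact: ultra_eq_trans.
  - by apply: US (UI ff' gg') => j /= [-> ->].
  - by apply: US (UI ff' gg') => j /= [-> ->].
have Er := ultra_eq_refl; have Es := ultra_eq_sym; have Et := ultra_eq_trans.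
rewrite /fo_sat; elim: p v => //= [t u|t u|p IHp q IHq|p IHp] v.
- rewrite !ev pi_quotP //; split; by apply: US => j; rewrite !eval_power.
- have ltE := @lt_quotient power_structure ultra_eq Er Es Et.
  rewrite !ev.
  have -> : (fun j => s_lt (eval (v^~ j) t) (eval (v^~ j) u)) =
            fun j => s_lt (@eval power_structure v t j) (@eval power_structure v u j).
    by apply/funext => j; rewrite !eval_power.
  apply: ltE => f f' g g' ff' gg' lfg.
  by apply: US (UI (UI ff' gg') lfg) => j [[-> ->]].
- by rewrite IHp IHq ultra_imp.
split=> [H|H q]; last first.
  rewrite -(repr_quotK q) (scons_pi_quot (E := ultra_eq)) repr_quotK; apply/IHp.
  by apply: US H => j /(_ (repr_quot q j)); congr sat; apply/funext; case.
case: (UC (fun j => forall x, sat (fun X : void => match X return K -> Prop with end)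
    (scons x (fun n => v n j)) p)) => // UnH; exfalso; apply: UF.
(* [f j] is a counterexample at [j] whenever there is one. If almost all indices had one, the class
   of [f] would be a counterexample in the ultrapower. *)
have /choice[f Hf] : forall j, exists x, ~ (forall x,
    sat (fun X : void => match X return K -> Prop with end) (scons x (fun n => v n j)) p) ->
    ~ sat (fun X : void => match X return K -> Prop with end) (scons x (fun n => v n j)) p.
  move=> j; have [Hj|/existsNP[x Hx]] := pselect (forall x,
    sat (fun X : void => match X return K -> Prop with end) (scons x (fun n => v n j)) p).
    by exists (s_zero K).
  by exists x.
have := H (pi_quot ultra_eq f).
have -> : scons (pi_quot ultra_eq f) (fun n => pi_quot ultra_eq (v n)) =
          fun n => pi_quot ultra_eq (scons f v n) by apply/funext; case.
move/IHp => UH; apply: US (UI UnH UH) => j [/Hf nH]; apply: contra_not nH.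
by congr sat; apply/funext; case.
Qed.

Lemma ultrapower_saturated : countably_saturated ultrapower.
Proof.
move=> Y DY Yfin.
have /choice[p Hp] : forall n, exists pv : fo_formula * (nat -> ultrapower),
    forall x, Y n x <-> fo_sat (scons x pv.2) pv.1.
  by move=> n; have [p [v H]] := DY n; exists (p, v).
pose good n x j := @fo_sat K (scons x (fun k => repr_quot ((p n).2 k) j)) (p n).1.
have YP n f : Y n (pi_quot ultra_eq f) <-> U (fun j => good n (f j) j).
  rewrite Hp; have -> : scons (pi_quot ultra_eq f) (p n).2 = fun k =>
      pi_quot ultra_eq (scons f (fun i => repr_quot ((p n).2 i)) k).
    by apply/funext => -[|k] //=; rewrite repr_quotK.
  rewrite los; split; apply: US => j; rewrite /good;
    by congr fo_sat; apply/funext; case.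
pose S n j := exists x, forall i, i < n -> good i x j.
have US' n : U (S n).
  have [x Hx] := Yfin n.
  have : U (fun j => forall i, i < n -> good i (repr_quot x j) j).
    by apply: ultra_forall_lt => i /Hx; rewrite -{1}(repr_quotK x) YP.
  by apply: US => j Hj; exists (repr_quot x j).
(* At index [j] meet as many of the first [j] requirements as possible. *)
have /choice[f Hf] : forall j, exists x, forall n, n <= j -> S n j ->
    forall i, i < n -> good i x j.
  move=> j; elim: {1}j => [|m [x IH]].
    by exists (s_zero K) => n; rewrite leqn0 => /eqP-> _ i.
  have [[y Hy]|nS] := pselect (S m.+1 j).
    by exists y => n nm _ i ni; apply: Hy; apply: leq_trans nm.
  exists x => n; rewrite leq_eqVlt => /orP[/eqP->//|]; rewrite ltnS; exact: IH.
exists (pi_quot ultra_eq f) => n; apply/YP.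
(* Almost every [j] is at least [n.+1] and lies in [S n.+1]; at such a [j] the value [f j] meets
   requirement [n]. *)
by apply: US (UI (Uoo n.+1) (US' n.+1)) => j [nj Sj]; exact: (Hf j n.+1 nj Sj n).
Qed.

End Ultrapower.

Theorem saturated_extension (K : structure) :
  exists N : structure, countably_saturated N /\
    forall p, sentence p -> (forall v : nat -> K, fo_sat v p) ->
      forall v : nat -> N, fo_sat v p.
Proof.
have [U [US UI UC UF Uoo]] := nonprincipal_ultrafilter.
exists (ultrapower K U); split; first exact: ultrapower_saturated.
move=> p sp Kp v; rewrite /fo_sat.
rewrite (sat_sentence (M := ultrapower K U) _ _ (fun n =>
   pi_quot (@ultra_eq K U) (fun _ => s_zero K)) sp).
apply/los => //; exact: US (Uoo 0).
Qed.

(** * Definability over a set of parameters *)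

Section Definability.
Variable N : structure.
Implicit Types (A B : N -> Prop) (R : (nat -> N) -> Prop) (us : seq N).

Definition cat_env us (v : nat -> N) : nat -> N := foldr (@scons N) v us.

Lemma cat_env_lt us v v' i : i < size us -> cat_env us v i = cat_env us v' i.
Proof. by elim: us i => [|a us IH] [|i] //=; apply: IH. Qed.

Lemma cat_env_ge us v i : cat_env us v (i + size us) = v i.
Proof. by elim: us => [|a us IH] /=; rewrite ?addn0 ?addnS. Qed.

Lemma cat_env_cat us us' v : cat_env (us ++ us') v = cat_env us (cat_env us' v).
Proof. exact: foldr_cat. Qed.

Lemma cat_env_catl us us' v i : i < size us ->
  cat_env (us ++ us') v i = cat_env us v i.
Proof. by rewrite cat_env_cat; apply: cat_env_lt. Qed.

Fixpoint all_in A us : Prop := if us is a :: us' then A a /\ all_in A us' else True.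

Lemma all_in_cat A us us' : all_in A us -> all_in A us' -> all_in A (us ++ us').
Proof. by elim: us => //= a us IH [Aa /IH]; auto. Qed.

Lemma all_in_mono A B us : (forall a, A a -> B a) -> all_in A us -> all_in B us.
Proof. by move=> AB; elim: us => //= a us IH [/AB Ba /IH]. Qed.

(** Relations are predicates on whole assignments, so that no arity is tracked. The parameters [us]
    occupy the first variables of [p] and the arguments come after them. *)
Definition dfn A R : Prop :=
  exists (p : fo_formula) us, all_in A us /\
    forall v, R v <-> fo_sat (cat_env us v) p.

Definition dfn1 A (Y : N -> Prop) : Prop := dfn A (fun v => Y (v 0)).

Definition dcl A (a : N) : Prop := dfn1 A (fun y => y = a).

Lemma dfn_ext A R R' : (forall v, R v <-> R' v) -> dfn A R -> dfn A R'.
Proof.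
by move=> RR' [p [us [Aus Rp]]]; exists p, us; split=> // v; rewrite -RR'.
Qed.

Lemma dfn_mono A B R : (forall a, A a -> B a) -> dfn A R -> dfn B R.
Proof.
move=> AB [p [us [Aus Rp]]]; exists p, us; split=> //; exact: all_in_mono Aus.
Qed.

Lemma fo_sat_rename (v : nat -> N) f (p : fo_formula) :
  fo_sat v (subst (fun n => Var (f n)) p) = fo_sat (fun n => v (f n)) p.
Proof. exact: sat_subst. Qed.

Lemma dfn_fo A p : dfn A (fun v => fo_sat v p).
Proof. by exists p, [::]. Qed.

Lemma dfn_imp A R R' : dfn A R -> dfn A R' -> dfn A (fun v => R v -> R' v).
Proof.
move=> [p [us [Aus Rp]]] [p' [us' [Aus' Rp']]].
(* With the parameter lists concatenated, [f] moves the arguments of [p] past [us'], and [f'] moves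
   all variables of [p'] past [us]. *)
pose f i := if i < size us then i else i + size us'.
pose f' i := i + size us.
exists (Imp (subst (fun n => Var (f n)) p) (subst (fun n => Var (f' n)) p')), (us ++ us').
split; first exact: all_in_cat.
move=> v; rewrite Rp Rp' /fo_sat /= -!/(fo_sat _ _) !fo_sat_rename.
have -> : (fun n => cat_env (us ++ us') v (f n)) = cat_env us v.
  apply/funext => i; rewrite /f; case: ltnP => [/cat_env_catl//|/subnK <-].
  rewrite cat_env_ge -addnA [size us + _]addnC addnA cat_env_cat.
  by rewrite cat_env_ge cat_env_ge.
have -> // : (fun n => cat_env (us ++ us') v (f' n)) = cat_env us' v.
by apply/funext => i; rewrite cat_env_cat cat_env_ge.
Qed.

Lemma dfn_not A R : dfn A R -> dfn A (fun v => ~ R v).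
Proof. by move=> dR; apply: dfn_imp dR (dfn_fo _ Bot). Qed.

Lemma dfn_and A R R' : dfn A R -> dfn A R' -> dfn A (fun v => R v /\ R' v).
Proof.
move=> dR dR'; apply: dfn_ext (dfn_not (dfn_imp dR (dfn_not dR'))) => v.
by have [?|?] := pselect (R v); have [?|?] := pselect (R' v); tauto.
Qed.

(* Renaming that moves variable 0 past the first [k] variables. *)
Definition sink (k i : nat) : nat :=
  if i < k then i.+1 else if i == k then 0 else i.

Lemma scons_sink us x v :
  (fun n => scons x (cat_env us v) (sink (size us) n)) = cat_env us (scons x v).
Proof.
apply/funext => i; rewrite /sink; case: ltngtP => [/cat_env_lt|/subnK <-|->] //=.
  by rewrite addnS -addSn cat_env_ge addSn /= cat_env_ge.
by rewrite -[size us in RHS]add0n cat_env_ge.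
Qed.

Lemma dfn_all A R : dfn A R -> dfn A (fun v => forall x, R (scons x v)).
Proof.
move=> [p [us [Aus Rp]]].
exists (All (subst (fun n => Var (sink (size us) n)) p)), us; split=> // v.
rewrite /fo_sat /=; split=> H x; have := H x;
  by rewrite Rp /fo_sat sat_subst -scons_sink.
Qed.

Lemma dfn_term A R (s : nat -> term) :
  dfn A R -> dfn A (fun v => R (fun n => eval v (s n))).
Proof.
move=> [p [us [Aus Rp]]].
pose r i := if i < size us then Var i else
  tsubst (fun n => Var (n + size us)) (s (i - size us)).
exists (subst r p), us; split=> // v; rewrite Rp /fo_sat sat_subst.
suff -> : (fun n => eval (cat_env us v) (r n)) =
          cat_env us (fun n => eval v (s n)) by [].
apply/funext => i; rewrite /r; case: ltnP => [/cat_env_lt H|/subnK <-]; first exact: H.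
rewrite cat_env_ge addnK eval_subst; congr eval; apply/funext => n.
exact: cat_env_ge.
Qed.

Lemma dfn_param A R a : A a -> dfn A R -> dfn A (fun v => R (scons a v)).
Proof.
move=> Aa [p [us [Aus Rp]]]; exists p, (us ++ [:: a]).
by split=> [|v]; [apply: all_in_cat | rewrite Rp cat_env_cat].
Qed.

(** An element of the definable closure can be quantified away, so it may serve as a parameter. *)
Lemma dfn_dcl A R a : dcl A a -> dfn A R -> dfn A (fun v => R (scons a v)).
Proof.
move=> da dR; apply: dfn_ext (dfn_all (dfn_imp da dR)) => v /=.
by split=> [/(_ a erefl)|Ra x ->].
Qed.

Lemma dfn_cat_env A R us :
  all_in (dcl A) us -> dfn A R -> dfn A (fun v => R (cat_env us v)).
Proof.
by elim: us R => //= a us IH R [da dus] dR; apply: IH dus (dfn_dcl da dR).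
Qed.

Lemma dcl_in A a : A a -> dcl A a.
Proof.
move=> Aa; have := dfn_param Aa (dfn_fo A (Eq (Var 1) (Var 0))).
exact: dfn_ext.
Qed.

Lemma dcl_term2 A (f : term -> term -> term) (h : N -> N -> N) a b :
  (forall v t u, eval v (f t u) = h (eval v t) (eval v u)) ->
  dcl A a -> dcl A b -> dcl A (h a b).
Proof.
move=> fh da db; have := dfn_dcl db (dfn_dcl da (dfn_fo A
  (Eq (Var 2) (f (Var 0) (Var 1))))).
by apply: dfn_ext => v; rewrite /fo_sat /= fh.
Qed.

(** Once set variables are replaced by definable sets, a matrix of second-order arithmetic is a
    first-order relation. The sets form a family indexed by [v 0], and definability is uniform in
    that index. *)
Lemma dfn_sat (SV : Type) A (V : SV -> N -> N -> Prop) (p : formula SV) :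
  (forall i, dfn A (fun v => V i (v 0) (v 1))) ->
  dfn A (fun v => sat (fun i y => V i y (v 0)) (fun n => v n.+1) p).
Proof.
move=> dV; elim: p => /= [t u|t u|t X||p IHp q IHq|p IHp].
- apply: dfn_ext (dfn_fo A (Eq (tsubst shift t) (tsubst shift u))) => v.
  by rewrite /fo_sat /= !eval_subst.
- apply: dfn_ext (dfn_fo A (Lt (tsubst shift t) (tsubst shift u))) => v.
  by rewrite /fo_sat /= !eval_subst.
- have := dfn_term (scons (tsubst shift t) Var) (dV X).
  by apply: dfn_ext => v /=; rewrite eval_subst.
- exact: (dfn_fo A Bot).
- exact: dfn_imp.
(* The index of the family sits at variable 0, so it is swapped with the variable to be bound before
   quantifying. *)
- have := dfn_all (dfn_term (scons (Var 1) (scons (Var 0) (fun n => Var n.+2))) IHp).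
  apply: dfn_ext => v; split=> H x; have := H x; congr sat; apply/funext; by case.
Qed.

(** The main device for proving definability: the set is written as a formula [p] over definable
    sets and elements. Variables beyond the tuple read [z], a filler that costs no extra
    parameter. *)
Lemma dfn1_sat (SV : Type) A (V : SV -> N -> N -> Prop) (p : formula SV) us :
  (forall i, dfn A (fun v => V i (v 0) (v 1))) -> all_in (dcl A) us ->
  dfn1 A (fun z => sat (fun i y => V i y z)
                       (scons z (cat_env us (fun _ => z))) p).
Proof.
move=> dV dus.
(* Behind the tuple, at index [size us], stands the point itself. Positions 0 and 1, the index of
   the family and the free variable of [p], both read it, as do all positions past the tuple. *)
pose s n := Var (if n is m.+2 then minn m (size us) else size us).
have := dfn_cat_env dus (dfn_term s (dfn_sat p dV)).
apply: dfn_ext => v /=; have ce : cat_env us v (size us) = v 0.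
  by rewrite -[size us]add0n cat_env_ge.
rewrite ce; suff -> : (fun n => cat_env us v
    match n with 0 => size us | m.+1 => minn m (size us) end) =
  scons (v 0) (cat_env us (fun _ => v 0)) by [].
apply/funext => -[|n] //=; rewrite /minn.
case: ltnP => [/cat_env_lt H|sn]; first exact: H.
by rewrite ce -(subnK sn) cat_env_ge.
Qed.

Lemma dfn1_Def A Y : dfn1 A Y -> Def Y.
Proof.
move=> [p [us [_ Yp]]].
exists (subst (fun n => Var (sink (size us) n)) p), (cat_env us (fun _ => s_zero N)) => x.
by rewrite (Yp (scons x (fun _ => s_zero N))) fo_sat_rename scons_sink.
Qed.

End Definability.

(** * Arithmetic in a model of PA *)

Declare Scope model_scope.
Delimit Scope model_scope with model.
Notation "0" := (s_zero _) : model_scope.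
Notation "1" := (s_one _) : model_scope.
Notation "x + y" := (s_add x y) : model_scope.
Notation "x * y" := (s_mul x y) : model_scope.
Notation "x < y" := (s_lt x y) : model_scope.

Definition num (N : structure) (k : nat) : N :=
  iter k (fun y => s_add y (s_one N)) (s_zero N).

Section Arithmetic.
Variable N : structure.
Hypothesis HPA : forall p, PA p -> forall v : nat -> N, fo_sat v p.
Local Open Scope model_scope.
Implicit Types (x y z : N) (A Y : N -> Prop).

Lemma sat_iter_all n (p : fo_formula) :
  (forall u : nat -> N, fo_sat u (iter n (@All void) p)) ->
  forall v : nat -> N, fo_sat v p.
Proof.
elim: n p => [//|n IH] p H v; rewrite (scons_eta v).
have {}H : forall u : nat -> N, fo_sat u (All p).
  by apply: IH => u; rewrite -iterSr; apply: H.
exact: H.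
Qed.

Lemma bounded_iter_all n k (p : fo_formula) :
  bounded k (iter n (@All void) p) = bounded (n + k) p.
Proof. by elim: n k => //= n IH k; rewrite IH addnS. Qed.

Lemma pa_ind (p : fo_formula) (v : nat -> N) :
  fo_sat (scons 0 v) p ->
  (forall x, fo_sat (scons x v) p -> fo_sat (scons (x + 1) v) p) ->
  forall x, fo_sat (scons x v) p.
Proof.
move=> p0 pS; have [k pk] := bounded_ex (Defs.induction p).
have /HPA/sat_iter_all/(_ v) : PA (iter k (@All void) (Defs.induction p)).
  by apply: PA_induction; rewrite /sentence bounded_iter_all addn0.
rewrite /fo_sat /= !sat_subst; apply.
  by move: p0; congr sat; apply/funext; case.
move=> x /pS; rewrite sat_subst.
by congr sat; apply/funext; case.
Qed.

Lemma dfn_ind A Y : dfn1 A Y ->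
  Y 0 -> (forall x, Y x -> Y (x + 1)) -> forall x, Y x.
Proof.
move=> /dfn1_Def[p [v Yp]] Y0 YS x; apply/Yp; apply: pa_ind; first exact/Yp.
by move=> y /Yp/YS/Yp.
Qed.

Lemma pa_succ_neq0 x : x + 1 <> 0.
Proof. exact: (HPA PA_succ_neq0 (fun _ => 0) x). Qed.

Lemma pa_succ_inj x y : x + 1 = y + 1 -> x = y.
Proof. exact: (HPA PA_succ_inj (fun _ => 0) x y). Qed.

Lemma pa_addx0 x : x + 0 = x.
Proof. exact: (HPA PA_add0 (fun _ => 0) x). Qed.

Lemma pa_addxS x y : x + (y + 1) = x + y + 1.
Proof. exact: (HPA PA_addS (fun _ => 0) x y). Qed.

Lemma pa_mulx0 x : x * 0 = 0.
Proof. exact: (HPA PA_mul0 (fun _ => 0) x). Qed.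

Lemma pa_mulxS x y : x * (y + 1) = x * y + x.
Proof. exact: (HPA PA_mulS (fun _ => 0) x y). Qed.

Lemma pa_ltP x y : x < y <-> exists z, x + (z + 1) = y.
Proof.
have := HPA PA_lt (fun _ => 0) x y; rewrite /fo_sat /= => H.
split=> [xy|[z xzy]]; apply: contrapT => nP; apply: H => H1 H2; apply: nP.
  by apply: contrapT => nz; apply: (H1 xy) => z zE; apply: nz; exists z.
by apply: H2 => /(_ z).
Qed.

Lemma pa_add0x x : 0 + x = x.
Proof.
apply: (pa_ind (p := Eq (Add Zero (Var 0)) (Var 0)) (v := fun _ => 0)).
  exact: pa_addx0.
by rewrite /fo_sat /= => y; rewrite pa_addxS => ->.
Qed.

Lemma pa_addA x y z : x + (y + z) = x + y + z.
Proof.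
move: z; apply: (pa_ind (p := Eq (Add (Var 1) (Add (Var 2) (Var 0)))
  (Add (Add (Var 1) (Var 2)) (Var 0))) (v := scons x (scons y (fun _ => 0)))).
  by rewrite /fo_sat /= !pa_addx0.
by rewrite /fo_sat /= => z IH; rewrite !pa_addxS IH.
Qed.

Lemma pa_addSx x y : x + 1 + y = x + y + 1.
Proof.
move: y; apply: (pa_ind (p := Eq (Add (Add (Var 1) One) (Var 0))
  (Add (Add (Var 1) (Var 0)) One)) (v := scons x (fun _ => 0))).
  by rewrite /fo_sat /= !pa_addx0.
by rewrite /fo_sat /= => y IH; rewrite !pa_addxS IH.
Qed.

Lemma pa_addC x y : x + y = y + x.
Proof.
move: y; apply: (pa_ind (p := Eq (Add (Var 1) (Var 0)) (Add (Var 0) (Var 1)))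
  (v := scons x (fun _ => 0))).
  by rewrite /fo_sat /= pa_addx0 pa_add0x.
by rewrite /fo_sat /= => y IH; rewrite pa_addxS pa_addSx IH.
Qed.

Lemma pa_mul0x x : 0 * x = 0.
Proof.
apply: (pa_ind (p := Eq (Mul Zero (Var 0)) Zero) (v := fun _ => 0)).
  exact: pa_mulx0.
by rewrite /fo_sat /= => y; rewrite pa_mulxS pa_addx0 => ->.
Qed.

Lemma pa_mulSx x y : (x + 1) * y = x * y + y.
Proof.
move: y; apply: (pa_ind (p := Eq (Mul (Add (Var 1) One) (Var 0))
  (Add (Mul (Var 1) (Var 0)) (Var 0))) (v := scons x (fun _ => 0))).
  by rewrite /fo_sat /= !pa_mulx0 pa_addx0.
rewrite /fo_sat /= => y IH; rewrite !pa_mulxS IH !pa_addxS.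
by rewrite -!(pa_addA (x * y)) (pa_addC y).
Qed.

Lemma pa_mulC x y : x * y = y * x.
Proof.
move: y; apply: (pa_ind (p := Eq (Mul (Var 1) (Var 0)) (Mul (Var 0) (Var 1)))
  (v := scons x (fun _ => 0))).
  by rewrite /fo_sat /= pa_mulx0 pa_mul0x.
by rewrite /fo_sat /= => y IH; rewrite pa_mulxS pa_mulSx IH.
Qed.

Lemma pa_mulDr x y z : x * (y + z) = x * y + x * z.
Proof.
move: z; apply: (pa_ind (p := Eq (Mul (Var 1) (Add (Var 2) (Var 0)))
  (Add (Mul (Var 1) (Var 2)) (Mul (Var 1) (Var 0))))
  (v := scons x (scons y (fun _ => 0)))).
  by rewrite /fo_sat /= pa_mulx0 !pa_addx0.
by rewrite /fo_sat /= => z IH; rewrite pa_addxS !pa_mulxS IH pa_addA.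
Qed.

Lemma pa_mulA x y z : x * (y * z) = x * y * z.
Proof.
move: z; apply: (pa_ind (p := Eq (Mul (Var 1) (Mul (Var 2) (Var 0)))
  (Mul (Mul (Var 1) (Var 2)) (Var 0))) (v := scons x (scons y (fun _ => 0)))).
  by rewrite /fo_sat /= !pa_mulx0.
by rewrite /fo_sat /= => z IH; rewrite !pa_mulxS pa_mulDr IH.
Qed.

Lemma pa_mulx1 x : x * 1 = x.
Proof. by rewrite -(pa_add0x 1) pa_mulxS pa_mulx0 pa_add0x. Qed.

Lemma pa_semi_ring :
  semi_ring_theory (s_zero N) (s_one N) (@s_add N) (@s_mul N) eq.
Proof.
split.
- exact: pa_add0x.
- exact: pa_addC.
- exact: pa_addA.
- by move=> x; rewrite pa_mulC pa_mulx1.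
- exact: pa_mul0x.
- exact: pa_mulC.
- exact: pa_mulA.
- by move=> x y z; rewrite !(pa_mulC _ z) pa_mulDr.
Qed.

Add Ring pa_ring : pa_semi_ring.

(** * Cancellation, order, remainders and least elements *)

Lemma pa_addIx x y z : x + z = y + z -> x = y.
Proof.
move: z; apply: (pa_ind (p := Imp (Eq (Add (Var 1) (Var 0)) (Add (Var 2) (Var 0)))
  (Eq (Var 1) (Var 2))) (v := scons x (scons y (fun _ => 0)))).
  by rewrite /fo_sat /= !pa_addx0.
by rewrite /fo_sat /= => z IH; rewrite !pa_addxS => /pa_succ_inj.
Qed.

Lemma pa_addxI x y z : z + x = z + y -> x = y.
Proof. by rewrite !(pa_addC z) => /pa_addIx. Qed.

Lemma pa_zeroVsucc x : x = 0 \/ exists y, x = y + 1.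
Proof.
suff : ~ (x <> 0 /\ forall y, x <> y + 1).
  move=> H; have [->|x0] := pselect (x = 0); [by left|right].
  by apply: contrapT => nx; apply: H; split=> // y xy; apply: nx; exists y.
move=> [x0 xS]; have := pa_ind (p := Imp (Neg (Eq (Var 0) Zero))
  (Neg (All (Neg (Eq (Var 1) (Add (Var 0) One)))))) (v := fun _ => 0).
rewrite /fo_sat /= => /(_ (fun h => False_ind _ (h erefl))) H.
by apply: (H _ x x0 xS) => y _ _ /(_ y).
Qed.

Lemma pa_ltxx x : ~ x < x.
Proof.
move/pa_ltP => [z xz]; apply: (@pa_succ_neq0 z); apply: (@pa_addxI _ _ x).
by rewrite xz pa_addx0.
Qed.

Lemma pa_lt_trans x y z : x < y -> y < z -> x < z.
Proof.
move=> /pa_ltP[a <-] /pa_ltP[b <-]; apply/pa_ltP; exists (a + 1 + b); ring.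
Qed.

Lemma pa_lt_or_ge x y : x < y \/ exists z, x = y + z.
Proof.
have [|nxy] := pselect (x < y); [by left|right].
apply: contrapT => nz; have {}nz z : x <> y + z by move=> xz; apply: nz; exists z.
have := pa_ind (p := Imp (Neg (Lt (Var 0) (Var 1)))
  (Neg (All (Neg (Eq (Var 1) (Add (Var 2) (Var 0))))))) (v := scons y (fun _ => 0)).
rewrite /fo_sat /= => H; apply: (H _ _ x nxy nz).
  move=> ny /(_ 0); apply; have [->|[y' yE]] := pa_zeroVsucc y.
    by rewrite pa_addx0.
  by case: ny; apply/pa_ltP; exists y'; rewrite yE pa_add0x.
move=> t IH nty tz; have [/pa_ltP[z zE]|nt] := pselect (t < y); last first.
  apply: (IH nt) => z tE; apply: (tz (z + 1)); rewrite tE; ring.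
have [z0|[z' z'E]] := pa_zeroVsucc z.
  by apply: (tz 0); rewrite -zE z0; ring.
by apply: nty; apply/pa_ltP; exists z'; rewrite -zE z'E; ring.
Qed.

Lemma pa_ltVeqVgt x y : [\/ x < y, x = y | y < x].
Proof.
have [xy|[z ->]] := pa_lt_or_ge x y; first by constructor 1.
have [->|[t ->]] := pa_zeroVsucc z; first by rewrite pa_addx0; constructor 2.
by constructor 3; apply/pa_ltP; exists t.
Qed.

Lemma pa_ltS x y : x < y + 1 -> x < y \/ x = y.
Proof.
move=> /pa_ltP[z]; rewrite pa_addxS => /pa_succ_inj <-.
have [->|[t ->]] := pa_zeroVsucc z; first by right; rewrite pa_addx0.
by left; apply/pa_ltP; exists t.
Qed.

Lemma pa_mulIx d x y : d <> 0 -> d * x = d * y -> x = y.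
Proof.
move=> d0; wlog: x y / x < y.
  move=> W; have [xy|//|yx] := pa_ltVeqVgt x y; first exact: W.
  by move=> /esym /(W _ _ yx).
move=> /pa_ltP[z <-]; rewrite pa_mulDr -{1}(pa_addx0 (d * x)) => /pa_addxI.
have [//|[d' ->]] := pa_zeroVsucc d.
by rewrite pa_mulxS pa_addxS => /esym /pa_succ_neq0.
Qed.

Lemma pa_mul_neq0 x y : x <> 0 -> y <> 0 -> x * y <> 0.
Proof. by move=> x0 y0; rewrite -(pa_mulx0 x) => /pa_mulIx; auto. Qed.

(** Uniqueness of remainders modulo [w]; it will make the residue [e] definable from the generic
    element and [w]. *)
Lemma pa_euclid_unique w e e' y y' :
  e < w -> e' < w -> e + w * y = e' + w * y' -> e = e'.
Proof.
wlog: e e' y y' / y < y' \/ y = y'.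
  move=> W ew e'w; have [yy'|yy'|yy'] := pa_ltVeqVgt y y'; first by apply: W; auto.
    by apply: W; auto.
  by move=> /esym /W H; apply/esym/H => //; left.
case=> [/pa_ltP[t <-]|<-] ew e'w; last exact: pa_addIx.
have -> : e' + w * (y + (t + 1)) = e' + w * t + w + w * y by ring.
move=> /pa_addIx eE; have [z ezw] := (pa_ltP _ _).1 ew; case: (@pa_ltxx w).
apply/pa_ltP; exists (e' + w * t + z); rewrite -{3}ezw eE; ring.
Qed.

Definition least Y m : Prop := Y m /\ forall y, y < m -> ~ Y y.

(** Without a least element, induction on [x] would show that nothing below [x] lies in [Y]. *)
Lemma least_exists A Y y : dfn1 A Y -> Y y -> exists m, least Y m.
Proof.
move=> dY Yy; apply: contrapT => nm.
have dZ : dfn1 A (fun x => forall y, y < x -> ~ Y y).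
  exact: (dfn1_sat (V := fun (_ : nat) y _ => Y y) (us := [::])
    (All (Imp (Lt (Var 0) (Var 1)) (Neg (Mem (Var 0) 0%N)))) (fun _ => dY) I).
have H : forall x y, y < x -> ~ Y y.
  apply: (dfn_ind dZ) => [z /pa_ltP[t]|x IH z /pa_ltS[/IH//|-> Yx]].
    by rewrite pa_addxS => /pa_succ_neq0.
  by apply: nm; exists x.
by apply: (H (y + 1) y) => //; apply/pa_ltP; exists 0; rewrite pa_add0x.
Qed.

Lemma least_unique Y m m' : least Y m -> least Y m' -> m = m'.
Proof.
move=> [Ym mY] [Ym' m'Y].
by have [/m'Y|//|/mY] := pa_ltVeqVgt m m'.
Qed.

(** Least elements act as definable Skolem functions: they turn mere existence into existence within
    the definable closure. *)
Lemma dcl_least A Y m : dfn1 A Y -> least Y m -> dcl A m.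
Proof.
move=> dY mY.
have dZ : dfn1 A (fun x => forall y, y < x -> ~ Y y).
  exact: (dfn1_sat (V := fun (_ : nat) y _ => Y y) (us := [::])
    (All (Imp (Lt (Var 0) (Var 1)) (Neg (Mem (Var 0) 0%N)))) (fun _ => dY) I).
apply: dfn_ext (dfn_and dY dZ) => v; split=> [vY|-> //].
exact: least_unique vY mY.
Qed.

Lemma num_lt j k : (j < k)%N -> num N j < num N k.
Proof.
elim: k => // k IH; rewrite ltnS leq_eqVlt => /orP[/eqP->|/IH jk].
  by apply/pa_ltP; exists 0; rewrite pa_add0x.
apply: pa_lt_trans jk _.
by apply/pa_ltP; exists 0; rewrite pa_add0x.
Qed.

Lemma num_inj : injective (num N).
Proof.
move=> j k jk; case: (ltngtP j k) => // /num_lt; rewrite jk; by move=> /pa_ltxx.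
Qed.

Lemma lt_num_standard k x : x < num N k -> standard x.
Proof.
elim: k => [|k IH] /=; last by move=> /pa_ltS[/IH //|->]; exists k.
by move=> /pa_ltP[z]; rewrite pa_addxS => /pa_succ_neq0.
Qed.

Lemma num_lt_nonstandard k w : ~ standard w -> num N k < w.
Proof.
move=> nw; have [//|kw|/lt_num_standard//] := pa_ltVeqVgt (num N k) w.
by case: nw; exists k.
Qed.

End Arithmetic.

(** * Generic elements for the topology of arithmetic progressions *)

Section Generic.
Variable N : structure.
Hypothesis HPA : forall p, PA p -> forall v : nat -> N, fo_sat v p.
Hypothesis Nsat : countably_saturated N.
Variable w : N.
Hypothesis w_nonstd : ~ standard w.
Local Open Scope model_scope.
Implicit Types (a b c d e x y z : N) (A X Z : N -> Prop).

Add Ring N_ring : (pa_semi_ring HPA).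

(* The progression [c + d * N] is coded by the pair [c], [d]; [dense X c d] says
   that [X] meets every subprogression of it. *)
Definition dense X c d : Prop :=
  forall u v, v <> 0 -> ~ forall y, ~ X (c + d * u + d * v * y).

Definition nowhere_dense X c d : Prop :=
  forall u v, v <> 0 -> ~ dense X (c + d * u) (d * v).

Definition refines c' d' c d : Prop :=
  exists u v, [/\ v <> 0, c' = c + d * u & d' = d * v].

Lemma refines_refl c d : refines c d c d.
Proof.
exists 0, 1; split; [|ring|ring].
by rewrite -(pa_add0x HPA 1); apply: pa_succ_neq0.
Qed.

Lemma refines_trans c1 d1 c2 d2 c3 d3 :
  refines c1 d1 c2 d2 -> refines c2 d2 c3 d3 -> refines c1 d1 c3 d3.
Proof.
move=> [u [v [v0 -> ->]]] [u' [v' [v'0 -> ->]]].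
exists (u' + v' * u), (v' * v); split; [exact: pa_mul_neq0|ring|ring].
Qed.

Lemma dense_refines X c d c' d' :
  refines c' d' c d -> dense X c d -> dense X c' d'.
Proof.
move=> cd' dX u' v' v'0 H.
have [u [v [v0 cE dE]]] : refines (c' + d' * u') (d' * v') c d.
  by apply: refines_trans cd'; exists u', v'.
by apply: (dX u v v0) => y; rewrite -cE -dE; apply: H.
Qed.

Lemma nowhere_dense_refines X c d c' d' :
  refines c' d' c d -> nowhere_dense X c d -> nowhere_dense X c' d'.
Proof.
move=> cd' nX u' v' v'0.
have [u [v [v0 -> ->]]] : refines (c' + d' * u') (d' * v') c d.
  by apply: refines_trans cd'; exists u', v'.
exact: nX.
Qed.

Lemma dense_mono X Z c d : (forall x, X x -> Z x) -> dense X c d -> dense Z c d.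
Proof.
by move=> XZ dX u v v0 H; apply: (dX u v v0) => y /XZ; apply: H.
Qed.

Lemma nowhere_dense_mono X Z c d :
  (forall x, X x -> Z x) -> nowhere_dense Z c d -> nowhere_dense X c d.
Proof. by move=> XZ nZ u v v0 /(dense_mono XZ); apply: nZ. Qed.

Lemma dense_ex X c d : dense X c d -> exists x, X x.
Proof.
move=> dX; apply: contrapT => nX; apply: (dX 0 1) => [|y Xy].
  by rewrite -(pa_add0x HPA 1); apply: pa_succ_neq0.
by apply: nX; eexists; exact: Xy.
Qed.

(** The intersection is not dense in the progression itself, the case [u = 0], [v = 1], so some
    subprogression misses it. There [X] is still dense and disjoint from [Z]. *)
Lemma dense_avoid X Z c d : dense X c d ->
  nowhere_dense (fun x => X x /\ Z x) c d ->
  exists c' d', refines c' d' c d /\ dense (fun x => X x /\ ~ Z x) c' d'.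
Proof.
move=> dX nZ; have := nZ 0 1; rewrite /dense => /(_ _) H.
have {H}/existsNP[u /existsNP[v /not_implyP[v0 /contrapT Hy]]] : ~ dense (fun x => X x /\ Z x) c d.
  move=> dZ; apply: H => [|u v v0].
    by rewrite -(pa_add0x HPA 1); apply: pa_succ_neq0.
  have -> : c + d * 0 = c by ring.
  have -> : d * 1 = d by ring.
  exact: dZ.
exists (c + d * u), (d * v); split; first by exists u, v.
have cd' : refines (c + d * u) (d * v) c d by exists u, v.
move=> u' v' v'0 H; apply: (dense_refines cd' dX (u := u') v'0) => y Xy; apply: (H y).
split=> // Zy; apply: (Hy (u' + v' * y)).
suff -> : c + d * u + d * v * (u' + v' * y) =
          c + d * u + d * v * u' + d * v * v' * y by [].
ring.
Qed.

(** A finite Baire category argument. It supplies the finite parts of a type, and saturation then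
    takes care of infinitely many nowhere dense sets. *)
Lemma dense_avoid_lt n (Z : nat -> N -> Prop) X c d : dense X c d ->
  (forall j, (j < n)%N -> nowhere_dense (fun x => X x /\ Z j x) c d) ->
  exists x, X x /\ forall j, (j < n)%N -> ~ Z j x.
Proof.
elim: n X c d => [|n IH] X c d dX nZ.
  by have [x Xx] := dense_ex dX; exists x.
have [c' [d' [cd' dX']]] := dense_avoid dX (nZ n (ltnSn n)).
have [|x [[Xx Znx] Hx]] := IH _ _ _ dX'.
  move=> j jn; apply: nowhere_dense_refines cd' _.
  by apply: nowhere_dense_mono (nZ j (ltnW jn)) => x [[]].
exists x; split=> // j; rewrite ltnS leq_eqVlt => /orP[/eqP->//|]; exact: Hx.
Qed.

Definition gen x : N -> Prop := fun y => y = x \/ y = w.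

(* A forcing condition: everything that has been decided about the generic
   element [x] can be recovered from [x] and [w]. *)
Definition condition X c d : Prop :=
  [/\ d <> 0, dense X c d
    & forall x, X x -> [/\ dfn1 (gen x) X, dcl (gen x) c & dcl (gen x) d]].

(** In the first case a standard number lies in the union of the [F n] for every candidate. The
    second case prepares a nonstandard number outside that union: the nowhere dense sets remain to
    be avoided by the final choice of the generic element. *)
Definition decided (F : nat -> N -> N -> Prop) X c d : Prop :=
  (exists n k, forall x, X x -> F n (num N k) x) \/
  (exists e, [/\ ~ standard e, forall x, X x -> dcl (gen x) e
    & forall n, nowhere_dense (fun x => X x /\ F n e x) c d]).

Lemma dcl_num A k : dcl A (num N k).
Proof.
elim: k => [|k IH]; first exact: (dfn_fo A (Eq (Var 0) Zero)).
exact: (dfn_dcl IH (dfn_fo A (Eq (Var 1) (Add (Var 0) One)))).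
Qed.

Lemma dcl_mul A a b : dcl A a -> dcl A b -> dcl A (a * b).
Proof. exact: (dcl_term2 (f := Mul)). Qed.

Lemma dcl_muladd A a b c : dcl A a -> dcl A b -> dcl A c -> dcl A (a + b * c).
Proof.
by move=> da db dc; apply: (dcl_term2 (f := Add)) => //; apply: dcl_mul.
Qed.

(** Expresses [dense] for set variable 0. The terms are lifted over the three quantifiers, and
    existence is spelled as in [dense], so that satisfaction unfolds to it by conversion. *)
Let denseF (c d : term) : formula nat :=
  let s := tsubst (fun n => Var n.+3) in
  All (All (Imp (Neg (Eq (Var 0) Zero)) (Neg (All (Neg (Mem
    (Add (Add (s c) (Mul (s d) (Var 2))) (Mul (Mul (s d) (Var 1)) (Var 0))) 0%N)))))).

Section Step.
Variable F : nat -> N -> N -> Prop.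
Hypothesis dF : forall n, dfn (eq w) (fun v => F n (v 0%N) (v 1%N)).

Lemma dF_gen x n : dfn (gen x) (fun v => F n (v 0%N) (v 1%N)).
Proof. by apply: dfn_mono (dF n) => a <-; right. Qed.

Lemma dfn1_F x n e : dcl (gen x) e -> dfn1 (gen x) (F n e).
Proof. by move=> de; have := dfn_dcl de (dF_gen x n); apply: dfn_ext. Qed.

(** The new progression has to be definable from each candidate and [w], so arbitrary witnesses do
    not suffice. The least possible [v] is taken first, then the least [u] for that [v]. *)
Lemma step_standard X c d n k u v : condition X c d -> v <> 0 ->
  dense (fun x => X x /\ F n (num N k) x) (c + d * u) (d * v) ->
  exists X' c' d', [/\ condition X' c' d', forall x, X' x -> X x,
    refines c' d' c d & decided F X' c' d'].
Proof.
move=> [d0 dX HX] v0 duv; pose X' x := X x /\ F n (num N k) x.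
have dX' x : X x -> dfn1 (gen x) X'.
  move=> /HX[dXx _ _]; apply: dfn_and dXx _; exact: dfn1_F (dcl_num _ _).
pose Rv v := exists u, v <> 0 /\ dense X' (c + d * u) (d * v).
have dRv x : X x -> dfn1 (gen x) Rv.
  move=> Xx; have [_ dc dd] := HX x Xx.
  have := dfn1_sat (V := fun (_ : nat) y _ => X' y) (us := [:: c; d])
    (Neg (All (Imp (Neg (Eq (Var 1) Zero)) (Neg (denseF
     (Add (Var 2) (Mul (Var 3) (Var 0))) (Mul (Var 3) (Var 1)))))))
    (fun _ => dX' x Xx) (conj dc (conj dd I)).
  apply: dfn_ext => h; split=> [H|[a [h0 da]] /= H]; last exact: (H a h0).
  by apply: contrapT => nh; apply: H => a h0 da; apply: nh; exists a.
(* The set [Rv] does not depend on the candidate. Its least element is found using one candidate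
   [x0], yet it is definable from every candidate in [X]. *)
have [x0 Xx0] := dense_ex dX.
have [v1 lv1] : exists v1, least Rv v1.
  by apply: (least_exists HPA (dRv x0 Xx0)) (ex_intro _ u (conj v0 duv)).
have dv1 x : X x -> dcl (gen x) v1 by move=> /dRv dR; apply: dcl_least dR lv1.
have [[u2 [v10 du2]] _] := lv1.
pose Ru u := dense X' (c + d * u) (d * v1).
have dRu x : X x -> dfn1 (gen x) Ru.
  move=> Xx; have [_ dc dd] := HX x Xx.
  exact: (dfn1_sat (V := fun (_ : nat) y _ => X' y) (us := [:: c; d; v1])
    (denseF (Add (Var 1) (Mul (Var 2) (Var 0))) (Mul (Var 2) (Var 3)))
    (fun _ => dX' x Xx) (conj dc (conj dd (conj (dv1 x Xx) I)))).
have [u1 lu1] : exists u1, least Ru u1 := least_exists HPA (dRu x0 Xx0) du2.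
have du1 x : X x -> dcl (gen x) u1 by move=> /dRu dR; apply: dcl_least dR lu1.
exists X', (c + d * u1), (d * v1); split; last 2 first.
- by exists u1, v1.
- by left; exists n, k => x [].
- split; [exact: pa_mul_neq0|exact: lu1.1|].
  move=> x X'x; have Xx := X'x.1; have [_ dc dd] := HX x Xx.
  split; [exact: dX'|apply: dcl_muladd|apply: dcl_mul] => //;
    [exact: du1|exact: dv1].
- by move=> x [].
Qed.

Lemma step_nonstandard X c d : condition X c d ->
  (forall n k, nowhere_dense (fun x => X x /\ F n (num N k) x) c d) ->
  exists X' c' d', [/\ condition X' c' d', forall x, X' x -> X x,
    refines c' d' c d & decided F X' c' d'].
Proof.
move=> [d0 dX HX] nF; have [x0 Xx0] := dense_ex dX.
have w0 : w <> 0 by move=> w0; apply: w_nonstd; exists 0%N.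
pose nd n z := nowhere_dense (fun x => X x /\ F n z x) c d.
(* The first [n] requirements hold at the numeral [num N n]: it is below the nonstandard [w],
   differs from all earlier numerals, and satisfies every [nd i] by [nF]. *)
have [|n|e He] := Nsat (Y := fun n z => z < w /\ z <> num N n /\ nd n z).
- move=> n; have [dXx dc dd] := HX x0 Xx0; apply: (@dfn1_Def _ (gen x0)).
  have dw : dcl (gen x0) w by apply: dcl_in; right.
  apply: dfn_and; first exact: (dfn_dcl dw (dfn_fo _ (Lt (Var 1) (Var 0)))).
  apply: dfn_and; first exact: dfn_not (dcl_num _ _).
  have dV : forall i : nat, dfn (gen x0) (fun v => X (v 0%N) /\ F n (v 1%N) (v 0%N)).
    move=> _; apply: dfn_and dXx _.
    exact: (dfn_term (scons (Var 1) (scons (Var 0) Var)) (dF_gen x0 n)).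
  exact: (dfn1_sat (V := fun (_ : nat) y z => X y /\ F n z y) (us := [:: c; d])
    (All (All (Imp (Neg (Eq (Var 0) Zero)) (Neg (denseF
      (Add (Var 3) (Mul (Var 4) (Var 1))) (Mul (Var 4) (Var 0)))))))
    dV (conj dc (conj dd I))).
- exists (num N n) => i ni; split; first exact: num_lt_nonstandard.
  by split; [move=> /(num_inj HPA) nE; rewrite nE ltnn in ni | apply: nF].
have e_nonstd : ~ standard e by case=> k ek; case: (He k) => _ [].
have [ew _] := He 0%N; pose c' := c + d * e; pose d' := d * w.
(* Membership of [x] in the new progression says that [(x - c) / d] has residue [e] modulo [w]. *)
have cd' : refines c' d' c d by exists e, w.
exists (fun x => X x /\ exists y, x = c' + d' * y), c', d'.
have dX' : dense (fun x => X x /\ exists y, x = c' + d' * y) c' d'.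
  move=> u v v0 H; apply: (dense_refines cd' dX (u := u) v0) => y Xy; apply: (H y).
  by split=> //; exists (u + v * y); ring.
have de x : X x -> (exists y, x = c' + d' * y) -> dcl (gen x) e.
  move=> Xx [y xE]; have [_ dc dd] := HX x Xx.
  have dw : dcl (gen x) w by apply: dcl_in; right.
  have dx : dcl (gen x) x by apply: dcl_in; left.
  have dlt := dfn_dcl dw (dfn_fo (gen x) (Lt (Var 1) (Var 0))).
  have dpr := dfn_dcl dc (dfn_dcl dd (dfn_dcl dw (dfn_dcl dx (dfn_fo (gen x)
    (Ex (Eq (Var 1) (Add (Add (Var 4) (Mul (Var 3) (Var 5)))
      (Mul (Mul (Var 3) (Var 2)) (Var 0))))))))).
  apply: dfn_ext (dfn_and dlt dpr) => v; rewrite /fo_sat /=; split.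
    (* Both representations of [x] have the form [c + d * (r + w * q)] with [r < w]; cancelling [c]
       and [d] leaves two divisions by [w]. *)
    move=> [vw /existsNP[z /contrapT xE']]; apply: (pa_euclid_unique HPA vw ew (y := z) (y' := y)).
    apply: (pa_mulIx HPA d0); apply: (pa_addxI HPA (z := c)).
    by transitivity x; [rewrite xE'|rewrite xE /c' /d']; ring.
  by move=> ->; split=> // /(_ y); apply.
split; last 2 first.
- exact: cd'.
- right; exists e; split=> // [x [Xx]|n]; first exact: de.
  apply: nowhere_dense_refines cd' _.
  by apply: nowhere_dense_mono (He n).2.2 => x [[]].
- split; [exact: pa_mul_neq0|exact: dX'|].
  move=> x [Xx Bx]; have [dXx dc dd] := HX x Xx; have dex := de x Xx Bx.
  have dw : dcl (gen x) w by apply: dcl_in; right.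
  have dc' : dcl (gen x) c' by apply: dcl_muladd.
  have dd' : dcl (gen x) d' by apply: dcl_mul.
  split=> //; apply: dfn_and dXx _.
  have := dfn_dcl dc' (dfn_dcl dd' (dfn_fo (gen x)
    (Ex (Eq (Var 3) (Add (Var 2) (Mul (Var 1) (Var 0))))))).
  apply: dfn_ext => v; rewrite /fo_sat /=; split=> [/existsNP[y /contrapT]|[y yE] /(_ y) //].
  by exists y.
- by move=> x [].
Qed.

Lemma generic_step X c d : condition X c d ->
  exists X' c' d', [/\ condition X' c' d', forall x, X' x -> X x,
    refines c' d' c d & decided F X' c' d'].
Proof.
move=> C.
have [[n [k [u [v [v0 H]]]]]|H] := pselect (exists n k u v, v <> 0 /\
    dense (fun x => X x /\ F n (num N k) x) (c + d * u) (d * v)).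
  exact: step_standard H.
apply: step_nonstandard C _ => n k u v v0 D; apply: H.
by exists n, k, u, v.
Qed.

End Step.

(** A descending sequence of conditions decides the [i]-th family at step [i]. Then [g] realizes the
    countable type of lying in every [X m] and outside every nowhere dense set left over by the
    decisions. *)
Theorem generic_exists (F : nat -> nat -> N -> N -> Prop) :
  (forall i n, dfn (eq w) (fun v => F i n (v 0%N) (v 1%N))) ->
  exists g, forall i,
    (exists n k, F i n (num N k) g) \/
    (exists e, [/\ dcl (gen g) e, ~ standard e & forall n, ~ F i n e g]).
Proof.
move=> dF.
have /choice[f Hf] : forall a : nat * ((N -> Prop) * N * N), exists S' : (N -> Prop) * N * N,
    condition a.2.1.1 a.2.1.2 a.2.2 ->
    [/\ condition S'.1.1 S'.1.2 S'.2, forall x, S'.1.1 x -> a.2.1.1 x,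
      refines S'.1.2 S'.2 a.2.1.2 a.2.2 & decided (F a.1) S'.1.1 S'.1.2 S'.2].
  move=> [i [[X c] d]] /=; have [C|nC] := pselect (condition X c d); last first.
    by exists (X, c, d).
  by have [X' [c' [d' H]]] := generic_step (dF i) C; exists (X', c', d').
pose fix st i := if i is j.+1 then f (j, st j) else (fun _ => True, 0, 1).
pose X i := (st i).1.1; pose c i := (st i).1.2; pose d i := (st i).2.
have C i : condition (X i) (c i) (d i).
  elim: i => [|i IH]; last by have [] := Hf (i, st i) IH.
  have n10 : (1 : N) <> 0 by rewrite -(pa_add0x HPA 1); apply: pa_succ_neq0.
  split=> // [u v v0 /(_ 0)|x _]; first exact.
  split; first by apply: dfn_ext (dfn_fo _ (Imp Bot Bot)) => v; split=> // _ [].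
    exact: (dfn_fo _ (Eq (Var 0) Zero)).
  exact: (dfn_fo _ (Eq (Var 0) One)).
have step i := Hf (i, st i) (C i).
have mono i j x : (i <= j)%N -> X j x -> X i x.
  move=> /subnK <-; elim: (j - i)%N x => // k IH x; rewrite addSn => Xx.
  by apply: IH; have [_ + _ _] := step (k + i)%N; apply.
have refi i j : (i <= j)%N -> refines (c j) (d j) (c i) (d i).
  move=> /subnK <-; elim: (j - i)%N => [|k IH]; first exact: refines_refl.
  rewrite addSn; apply: refines_trans IH.
  by have [] := step (k + i)%N.
pose std i := exists n k, forall x, X i.+1 x -> F i n (num N k) x.
have /choice[e He] : forall i, exists e, ~ std i ->
    [/\ ~ standard e, forall x, X i.+1 x -> dcl (gen x) e
    & forall n, nowhere_dense (fun x => X i.+1 x /\ F i n e x) (c i.+1) (d i.+1)].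
  move=> i; have [_ _ _ [H|[e He]]] := step i; last by exists e.
  by exists 0 => /(_ H).
pose idx m : nat * nat := nth_of (0%N, 0%N) m.
(* For families decided at a standard number there is nothing to avoid, so [Z i n] is empty and
   [e i] is arbitrary; one type then covers both cases. *)
pose Z i n x := ~ std i /\ F i n (e i) x.
have [m|m|g Hg] := Nsat (Y := fun m x => X m x /\ ~ Z (idx m).1 (idx m).2 x).
- have [_ dX HX] := C m; have [x0 Xx0] := dense_ex dX; have [dXm _ _] := HX x0 Xx0.
  apply: (@dfn1_Def _ (fun=> True)); apply: dfn_and.
    exact: dfn_mono dXm.
  case: (idx m) => i n /=; have [si|nsi] := pselect (std i).
    apply: dfn_ext (dfn_fo _ (Imp Bot Bot)) => v; split=> // _ [] //.
  have dFe : dfn (fun=> True) (fun v => F i n (v 0%N) (v 1%N)) by apply: dfn_mono (dF i n).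
  have := dfn_not (dfn_param (a := e i) I dFe); apply: dfn_ext => v /=.
  by split=> [nF [_ //]|nZ Fi]; apply: nZ.
(* The stage [M] comes after [m] and after the decision of each family occurring among the first [m]
   requirements. The corresponding sets [Z] are therefore nowhere dense relative to [X M] in its
   progression. *)
- pose M := (m + \sum_(j < m) (idx j).1.+1)%N.
  have idxM j : (j < m)%N -> ((idx j).1 < M)%N.
    move=> jm; rewrite /M (bigD1 (Ordinal jm)) //= addnCA; exact: leq_addr.
  have [_ dX _] := C M.
  have [|x [Xx Hx]] := dense_avoid_lt (n := m) (Z := fun j => Z (idx j).1 (idx j).2) dX.
    move=> j jm; have ijM := idxM j jm; move: (idx j) ijM => [i n] /= iM.
    have [si|nsi] := pselect (std i).
      move=> u v v0 dZ; have [x [_ []]] := dense_ex dZ; exact.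
    have [_ _ ndi] := He i nsi.
    apply: nowhere_dense_refines (refi _ _ iM) _.
    by apply: nowhere_dense_mono (ndi n) => x [XMx [_ Fx]]; split=> //; apply: mono XMx.
  exists x => j jm; split; last exact: Hx.
  apply: mono Xx; apply: leq_trans (ltnW jm) _; exact: leq_addr.
exists g => i; have [[n [k H]]|nsi] := pselect (std i).
  by left; exists n, k; apply: H; apply: (Hg i.+1).1.
have [e_nonstd de _] := He i nsi; right; exists (e i); split=> //.
  by apply: de; apply: (Hg i.+1).1.
move=> n Fn; have [m mE] := nth_of_surj (0%N, 0%N) (i, n).
by apply: (Hg m).2; rewrite /idx mE.
Qed.

End Generic.

(** * A recursive enumeration of all formulas *)

Definition recursive1 (f : nat -> nat) := @recursive 1 (fun v => f (thead v)).

Definition recursive2 (f : nat -> nat -> nat) :=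
  @recursive 2 (fun v => f (thead v) (thead [tuple of behead v])).

Section RecursiveClosure.
Variable k : nat.
Implicit Types g : k.-tuple nat -> nat.

Lemma recursive_comp1 f g :
  recursive1 f -> recursive g -> recursive (fun v => f (g v)).
Proof.
move=> Rf Rg; apply: rec_ext (rec_comp (g := fun _ : 'I_1 => g) Rf (fun _ => Rg)).
by move=> v /=; rewrite /thead tnth_mktuple.
Qed.

Lemma recursive_comp2 f g1 g2 : recursive2 f -> recursive g1 -> recursive g2 ->
  recursive (fun v => f (g1 v) (g2 v)).
Proof.
move=> Rf Rg1 Rg2.
have Rg (i : 'I_2) : recursive (if i == ord0 then g1 else g2) by case: ifP.
apply: rec_ext (rec_comp Rf Rg) => v /=.
by rewrite /thead !(tnth_behead, tnth_mktuple) eqxx -val_eqE /= inordK.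
Qed.

Lemma recursive_const c : recursive (fun _ : k.-tuple nat => c).
Proof.
elim: c => [|c IH]; first exact: rec_zero.
exact: recursive_comp1 rec_succ IH.
Qed.

End RecursiveClosure.

Lemma recursive_arg1 k : recursive (fun v : k.+1.-tuple nat => thead v).
Proof. exact: rec_proj. Qed.

Lemma recursive_arg2 k :
  recursive (fun v : k.+2.-tuple nat => thead [tuple of behead v]).
Proof.
apply: rec_ext (rec_proj (inord 1)) => v; rewrite /thead tnth_behead.
by congr tnth; apply/val_inj; rewrite /= inordK.
Qed.

Lemma recursive_arg3 k :
  recursive (fun v : k.+3.-tuple nat => thead [tuple of behead [tuple of behead v]]).
Proof.
apply: rec_ext (rec_proj (inord 2)) => v; rewrite /thead !tnth_behead.
by congr tnth; apply/val_inj; rewrite /= !inordK.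
Qed.

Lemma recursive_prim1 a (f : nat -> nat -> nat) : recursive2 f ->
  recursive1 (fun n => nat_rect (fun _ => nat) a f n).
Proof.
move=> Rf; have := rec_prim (recursive_const 0 a) Rf; apply: rec_ext => v /=.
by elim: (thead v) => //= n ->; rewrite !theadE.
Qed.

Lemma recursive_prim2 (f : nat -> nat) (h : nat -> nat -> nat -> nat) :
  recursive1 f ->
  @recursive 3 (fun v => h (thead v) (thead [tuple of behead v])
                           (thead [tuple of behead [tuple of behead v]])) ->
  recursive2 (fun n x => nat_rect (fun _ => nat) (f x) (fun n r => h n r x) n).
Proof.
move=> Rf Rh; have := rec_prim Rf Rh; apply: rec_ext => v /=.
elim: (thead v) => //= n ->; rewrite !theadE.
by congr h; congr thead; apply/val_inj.
Qed.

Lemma recursive_add : recursive2 addn.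
Proof.
have := recursive_prim2 (f := id) (h := fun _ r _ => r.+1) (recursive_arg1 0)
  (recursive_comp1 rec_succ (recursive_arg2 1)).
apply: rec_ext => v; by elim: (thead v) => //= n ->.
Qed.

Lemma recursive_mul : recursive2 muln.
Proof.
have := recursive_prim2 (f := fun _ => 0) (h := fun _ r x => x + r) (recursive_const 1 0)
  (recursive_comp2 recursive_add (recursive_arg3 0) (recursive_arg2 1)).
apply: rec_ext => v; by elim: (thead v) => //= n ->; rewrite mulSn.
Qed.

Lemma recursive_pred : recursive1 predn.
Proof.
have := recursive_prim1 0 (f := fun n _ => n) (recursive_arg1 1).
by apply: rec_ext => v; case: (thead v).
Qed.

Lemma recursive_sub : recursive2 subn.
Proof.
have : recursive2 (fun n x => x - n).
  have := recursive_prim2 (f := id) (h := fun _ r _ => r.-1) (recursive_arg1 0)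
    (recursive_comp1 recursive_pred (recursive_arg2 1)).
  by apply: rec_ext => v; elim: (thead v) => //= [|n ->]; rewrite ?subn0 ?subnS.
move=> H; exact: (recursive_comp2 H (recursive_arg2 0) (recursive_arg1 1)).
Qed.

(** * Recursive inverses of the Cantor pairing *)

Definition triangle (n : nat) : nat := (n * n.+1)./2.
Arguments triangle : simpl never.

Lemma triangleS n : triangle n.+1 = triangle n + n.+1.
Proof.
by rewrite /triangle mulnC -[in LHS]addn2 mulnDl mul2n halfD odd_double andbF doubleK.
Qed.

Lemma triangle_mono : {homo triangle : m n / m <= n}.
Proof.
move=> m n /subnK <-; elim: (n - m) => // k IH; rewrite addSn triangleS.
by apply: leq_trans IH _; apply: leq_addr.
Qed.

Lemma leq_triangle n : n <= triangle n.
Proof. by elim: n => // n IH; rewrite triangleS leq_addl. Qed.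

Lemma recursive_triangle : recursive1 triangle.
Proof.
have := recursive_prim1 0 (f := fun n r => r + n.+1) (recursive_comp2 recursive_add
  (recursive_arg2 0) (recursive_comp1 rec_succ (recursive_arg1 1))).
by apply: rec_ext => v; elim: (thead v) => // n IH; rewrite triangleS -IH.
Qed.

Lemma cantor_pairE a b : cantor_pair a b = triangle (a + b) + b.
Proof. by []. Qed.

Lemma recursive_pair : recursive2 cantor_pair.
Proof.
apply: (recursive_comp2 recursive_add _ (recursive_arg2 0)).
by apply: (recursive_comp1 recursive_triangle); apply: recursive_add.
Qed.

Fact diagonal_subproof n : exists s, n < triangle s.+1.
Proof. by exists n; apply: leq_triangle. Qed.

Definition diagonal n := ex_minn (diagonal_subproof n).
Definition unpair2 n := n - triangle (diagonal n).
Definition unpair1 n := diagonal n - unpair2 n.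

Lemma diagonal_pair a b : diagonal (cantor_pair a b) = a + b.
Proof.
rewrite /diagonal cantor_pairE; case: ex_minnP => s ls mins.
apply/eqP; rewrite eqn_leq mins /=; last by rewrite triangleS ltn_add2l ltnS leq_addl.
rewrite leqNgt; apply/negP => /triangle_mono sab.
by have := leq_trans ls sab; rewrite ltnNge leq_addr.
Qed.

Lemma cantor_pairK2 a b : unpair2 (cantor_pair a b) = b.
Proof. by rewrite /unpair2 diagonal_pair cantor_pairE addKn. Qed.

Lemma cantor_pairK1 a b : unpair1 (cantor_pair a b) = a.
Proof. by rewrite /unpair1 cantor_pairK2 diagonal_pair addnK. Qed.

Lemma leq_pair1 a b : a <= cantor_pair a b.
Proof.
by rewrite cantor_pairE (leq_trans (leq_addr b a)) // (leq_trans (leq_triangle _)) ?leq_addr.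
Qed.

Lemma leq_pair2 a b : b <= cantor_pair a b.
Proof. exact: leq_addl. Qed.

Lemma ltn_pair2 a b : 0 < a -> b < cantor_pair a b.
Proof.
move=> a0; rewrite cantor_pairE -[X in X < _]add0n ltn_add2r.
by apply: leq_trans (leq_triangle _); rewrite addn_gt0 a0.
Qed.

Lemma recursive_diagonal : recursive1 diagonal.
Proof.
(* With arguments [s] and [n], this truncated difference vanishes exactly when [n < triangle s.+1],
   so minimization over [s] returns the diagonal of [n]. *)
pose f (v : 2.-tuple nat) := (thead [tuple of behead v]).+1 - triangle (thead v).+1.
apply: (@rec_mu _ f).
  apply: (recursive_comp2 recursive_sub).
    exact: (recursive_comp1 rec_succ (recursive_arg2 0)).
  apply: (recursive_comp1 recursive_triangle).
  exact: (recursive_comp1 rec_succ (recursive_arg1 1)).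
move=> v; have fE s : f [tuple of s :: v] = (thead v).+1 - triangle s.+1.
  by rewrite /f theadE; congr ((thead _).+1 - _); apply/val_inj.
rewrite /diagonal; case: ex_minnP => s ls mins; rewrite fE.
split=> [|m ms]; first by apply/eqP; rewrite subn_eq0.
rewrite fE; apply/eqP; rewrite subn_eq0; apply/negP => /mins.
by rewrite leqNgt ms.
Qed.

Lemma recursive_unpair2 : recursive1 unpair2.
Proof.
apply: (recursive_comp2 recursive_sub (recursive_arg1 0)).
exact: (recursive_comp1 recursive_triangle recursive_diagonal).
Qed.

Lemma recursive_unpair1 : recursive1 unpair1.
Proof. exact: (recursive_comp2 recursive_sub recursive_diagonal recursive_unpair2). Qed.

Definition ifz (c a b : nat) : nat := if c is 0 then a else b.

Lemma recursive_ifz k (c a b : k.-tuple nat -> nat) :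
  recursive c -> recursive a -> recursive b ->
  recursive (fun v => ifz (c v) (a v) (b v)).
Proof.
move=> Rc Ra Rb.
(* Truncated subtraction gives the indicators [1 - c] of zero and [1 - (1 - c)] of nonzero
   values. *)
have R1 := recursive_comp2 recursive_sub (recursive_const k 1) Rc.
have R2 := recursive_comp2 recursive_sub (recursive_const k 1) R1.
have := recursive_comp2 recursive_add (recursive_comp2 recursive_mul R1 Ra)
  (recursive_comp2 recursive_mul R2 Rb).
apply: rec_ext => v; case: (c v) => [|n] /=.
  by rewrite subn0 subnn mul1n mul0n addn0.
by rewrite subSS sub0n subn0 mul0n mul1n.
Qed.

Definition lookup (h j : nat) : nat := unpair1 (iter j unpair2 h).

Lemma recursive_lookup : recursive2 lookup.
Proof.
have R : recursive2 (fun j h => iter j unpair2 h).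
  have := recursive_prim2 (f := id) (h := fun _ r _ => unpair2 r) (recursive_arg1 0)
    (recursive_comp1 recursive_unpair2 (recursive_arg2 1)).
  by apply: rec_ext => v; elim: (thead v) => //= n ->.
apply: (recursive_comp1 recursive_unpair1).
exact: (recursive_comp2 R (recursive_arg2 0) (recursive_arg1 1)).
Qed.

Ltac recur := repeat lazymatch goal with
  | |- recursive (fun v => ifz (@?c v) (@?a v) (@?b v)) => apply: recursive_ifz
  | |- recursive (fun v => cantor_pair (@?a v) (@?b v)) =>
      apply: (recursive_comp2 recursive_pair)
  | |- recursive (fun v => (@?a v) + (@?b v)) =>
      apply: (recursive_comp2 recursive_add)
  | |- recursive (fun v => (@?a v) - (@?b v)) =>
      apply: (recursive_comp2 recursive_sub)
  | |- recursive (fun v => lookup (@?a v) (@?b v)) =>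
      apply: (recursive_comp2 recursive_lookup)
  | |- recursive (fun v => unpair1 (@?a v)) =>
      apply: (recursive_comp1 recursive_unpair1)
  | |- recursive (fun v => unpair2 (@?a v)) =>
      apply: (recursive_comp1 recursive_unpair2)
  | |- recursive (fun v => (@?a v).-1) =>
      apply: (recursive_comp1 recursive_pred)
  | |- recursive (fun v => (@?a v).+1) => apply: (recursive_comp1 rec_succ)
  | |- recursive _ => first [ exact: recursive_arg1 | exact: recursive_arg2
                            | apply: recursive_const ]
  end.

(* Course-of-values recursion: [step n L] computes the [n]-th item from the list
   [L] of the previous ones, latest first. *)
Section CourseOfValues.
Variables (A : Type) (a0 : A) (step : nat -> seq A -> A) (c : A -> nat).

Fixpoint history n : seq A :=
  if n is m.+1 then step m (history m) :: history m else [::].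

Definition value n := step n (history n).

Lemma nth_history n m : m < n -> nth a0 (history n) (n - m.+1) = value m.
Proof.
elim: n => // n IH; rewrite ltnS leq_eqVlt => /orP[/eqP->|mn].
  by rewrite subnn.
by rewrite subSS -[n - m]prednK ?subn_gt0 //= -subnS IH.
Qed.

Definition history_code (L : seq A) : nat := foldr (fun a r => cantor_pair (c a) r) 0 L.

(** The number 0 is the pair of 0 and 0, so the code of the empty list decodes to zeros forever.
    Reading past the end of a list agrees with the default [a0] if that has code 0. *)
Hypothesis c0 : c a0 = 0.

Lemma lookup_history_code L j : lookup (history_code L) j = c (nth a0 L j).
Proof.
have u0 : unpair1 0 = 0 /\ unpair2 0 = 0.
  by rewrite -[0]/(cantor_pair 0 0) cantor_pairK1 cantor_pairK2.
rewrite /lookup; elim: j L => [|j IH] [|a L] //=.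
- by rewrite c0 u0.1.
- by rewrite cantor_pairK1.
- by rewrite -iterS iterSr u0.2; have := IH [::]; rewrite nth_nil.
- by rewrite -iterS iterSr cantor_pairK2 IH.
Qed.

(** The code of the entire history is obtained by primitive recursion, each step pairing the new
    item with the old code. *)
Lemma recursive_value S : recursive2 S ->
  (forall n L, c (step n L) = S n (history_code L)) ->
  recursive1 (fun n => c (value n)).
Proof.
move=> RS cS; have Rh : recursive1 (fun n => history_code (history n)).
  have := recursive_prim1 0 (f := fun n r => cantor_pair (S n r) r)
    (recursive_comp2 recursive_pair RS (recursive_arg2 0)).
  by apply: rec_ext => v; elim: (thead v) => //= n ->; rewrite cS.
have := recursive_comp2 RS (recursive_arg1 0) Rh.
by apply: rec_ext => v; rewrite /value cS.
Qed.

End CourseOfValues.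

(** Decodes [n] into a constructor tag and arguments, fetching the subterm with number [a] at
    position [n - a.+1] because the latest value comes first. Every number yields some term: all
    tags above 3 are read as products. *)
Definition term_step (n : nat) (L : seq term) : term :=
  let m := unpair2 n in
  let get a := nth (Var 0) L (n - a.+1) in
  match unpair1 n with
  | 0 => Var m
  | 1 => Zero
  | 2 => One
  | 3 => Add (get (unpair1 m)) (get (unpair2 m))
  | _ => Mul (get (unpair1 m)) (get (unpair2 m))
  end.

Definition term_value := value term_step.

Lemma recursive_term_value : recursive1 (fun n => tcode (term_value n)).
Proof.
(* This is [term_step] carried out on codes, with [h] coding the list of earlier terms. *)
pose S n h :=
  let m := unpair2 n in let t := unpair1 n in
  let p i := cantor_pair i (cantor_pair (lookup h (n - (unpair1 m).+1))
                                        (lookup h (n - (unpair2 m).+1))) in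
  ifz t (cantor_pair 0 m) (ifz t.-1 (cantor_pair 1 0) (ifz t.-1.-1 (cantor_pair 2 0)
    (ifz t.-1.-1.-1 (p 3) (p 4)))).
apply: (@recursive_value _ _ tcode S); first by rewrite /S /recursive2; recur.
move=> n L; have lk := @lookup_history_code _ (Var 0) tcode erefl L.
by rewrite /S /term_step !lk; case: (unpair1 n) => [|[|[|[|t]]]].
Qed.

Lemma term_value_surj t : exists n, term_value n = t.
Proof.
(* A positive tag makes the pair exceed its second component, so both subterms were enumerated
   before [n]. *)
have V i a b n : n = cantor_pair i.+1 (cantor_pair a b) -> a < n /\ b < n.
  move=> ->; split; apply: leq_ltn_trans (ltn_pair2 _ _) => //.
    exact: leq_pair1.
  exact: leq_pair2.
elim: t => [n|||t [a <-] u [b <-]|t [a <-] u [b <-]].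
- by exists (cantor_pair 0 n); rewrite /term_value /value /term_step cantor_pairK1 cantor_pairK2.
- by exists (cantor_pair 1 0); rewrite /term_value /value /term_step cantor_pairK1.
- by exists (cantor_pair 2 0); rewrite /term_value /value /term_step cantor_pairK1.
- set n := cantor_pair 3 (cantor_pair a b); exists n.
  have [an bn] := V 2 a b n erefl; rewrite /term_value /value {1}/term_step.
  rewrite [in unpair1 n]/n [in unpair2 n]/n !(cantor_pairK1, cantor_pairK2).
  by rewrite !nth_history.
- set n := cantor_pair 4 (cantor_pair a b); exists n.
  have [an bn] := V 3 a b n erefl; rewrite /term_value /value {1}/term_step.
  rewrite [in unpair1 n]/n [in unpair2 n]/n !(cantor_pairK1, cantor_pairK2).
  by rewrite !nth_history.
Qed.

Definition formula_step (n : nat) (L : seq fo_formula) : fo_formula :=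
  let m := unpair2 n in
  let get a := nth (Eq (Var 0) (Var 0)) L (n - a.+1) in
  match unpair1 n with
  | 0 => Eq (term_value (unpair1 m)) (term_value (unpair2 m))
  | 1 => Lt (term_value (unpair1 m)) (term_value (unpair2 m))
  | 2 => Bot
  | 3 => Imp (get (unpair1 m)) (get (unpair2 m))
  | _ => All (get m)
  end.

Definition formula_value := value formula_step.

Lemma recursive_formula_value : recursive1 (fun n => code (formula_value n)).
Proof.
pose S n h :=
  let m := unpair2 n in let t := unpair1 n in
  let p i := cantor_pair i (cantor_pair (tcode (term_value (unpair1 m)))
                                        (tcode (term_value (unpair2 m)))) in
  ifz t (p 0) (ifz t.-1 (p 1) (ifz t.-1.-1 (cantor_pair 2 0)
    (ifz t.-1.-1.-1 (cantor_pair 3 (cantor_pair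
       (lookup h (n - (unpair1 m).+1)) (lookup h (n - (unpair2 m).+1))))
       (cantor_pair 4 (lookup h (n - m.+1)))))).
apply: (@recursive_value _ _ code S).
  rewrite /S /recursive2; recur; apply: (recursive_comp1 recursive_term_value);
    by recur.
move=> n L; have lk := @lookup_history_code _ (Eq (Var 0) (Var 0)) code erefl L.
by rewrite /S /formula_step !lk; case: (unpair1 n) => [|[|[|[|t]]]].
Qed.

Lemma formula_value_surj p : exists n, formula_value n = p.
Proof.
elim: p => [t u|t u|t []||p [a <-] q [b <-]|p [a <-]].
- have [a <-] := term_value_surj t; have [b <-] := term_value_surj u.
  exists (cantor_pair 0 (cantor_pair a b)).
  by rewrite /formula_value /value /formula_step !(cantor_pairK1, cantor_pairK2).
- have [a <-] := term_value_surj t; have [b <-] := term_value_surj u.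
  exists (cantor_pair 1 (cantor_pair a b)).
  by rewrite /formula_value /value /formula_step !(cantor_pairK1, cantor_pairK2).
- by exists (cantor_pair 2 0); rewrite /formula_value /value /formula_step cantor_pairK1.
- set n := cantor_pair 3 (cantor_pair a b); exists n.
  have an : a < n by apply: leq_ltn_trans (ltn_pair2 _ _) => //; apply: leq_pair1.
  have bn : b < n by apply: leq_ltn_trans (ltn_pair2 _ _) => //; apply: leq_pair2.
  rewrite /formula_value /value {1}/formula_step.
  rewrite [in unpair1 n]/n [in unpair2 n]/n !(cantor_pairK1, cantor_pairK2).
  by rewrite !nth_history.
- set n := cantor_pair 4 a; exists n.
  have an : a < n by apply: ltn_pair2.
  rewrite /formula_value /value {1}/formula_step.
  rewrite [in unpair1 n]/n [in unpair2 n]/n !(cantor_pairK1, cantor_pairK2).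
  by rewrite nth_history.
Qed.

(** * Finitely generated models are not recursively saturated *)

Lemma leq_pair_pair i a b :
  (a <= cantor_pair i (cantor_pair a b)) && (b <= cantor_pair i (cantor_pair a b)).
Proof.
by rewrite !(leq_trans _ (leq_pair2 i _)) ?leq_pair1 ?leq_pair2.
Qed.

Lemma tbounded_tcode t : tbounded (tcode t).+1 t.
Proof.
elim: t => //= [n|t IHt u IHu|t IHt u IHu]; first by rewrite ltnS leq_pair2.
- have /andP[lt lu] := leq_pair_pair 3 (tcode t) (tcode u).
  by rewrite (tbounded_mono _ IHt) ?(tbounded_mono _ IHu).
- have /andP[lt lu] := leq_pair_pair 4 (tcode t) (tcode u).
  by rewrite (tbounded_mono _ IHt) ?(tbounded_mono _ IHu).
Qed.

(** Pairing dominates its arguments, so the code bounds all variable indices. This gives a recursive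
    count of quantifiers sufficient to close [p]. *)
Lemma bounded_code p : bounded (code p).+1 p.
Proof.
elim: p => [t u|t u|t []||p IHp q IHq|p IHp] //=.
- have /andP[lt lu] := leq_pair_pair 0 (tcode t) (tcode u).
  by rewrite (tbounded_mono _ (tbounded_tcode t)) ?(tbounded_mono _ (tbounded_tcode u)).
- have /andP[lt lu] := leq_pair_pair 1 (tcode t) (tcode u).
  by rewrite (tbounded_mono _ (tbounded_tcode t)) ?(tbounded_mono _ (tbounded_tcode u)).
- have /andP[lp lq] := leq_pair_pair 3 (code p) (code q).
  by rewrite (bounded_mono _ IHp) ?(bounded_mono _ IHq).
- by apply: bounded_mono IHp; rewrite ltnS ltnW // ltnS leq_pair2.
Qed.

(* [v_(i+1) = a_i] for all [i] in [s] implies [p], where the parameter [a_i] is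
   read below [k] quantifiers and the variable [x]. *)
Definition params_imp (k : nat) (s : seq nat) (p : fo_formula) : fo_formula :=
  foldr (fun i q => Imp (Eq (Var i.+1) (Var (k + i.+1))) q) p s.

(* "[q(., a)] does not define [x]", for an [m]-tuple [a]. The quantifiers bind
   all the variables of [q], so that [q] is used without substitution. *)
Definition undefined_by (m : nat) (q : fo_formula) : fo_formula :=
  let k := code q + m.+1 in
  Neg (iter k (@All void) (params_imp k (iota 0 m) (Iff q (Eq (Var 0) (Var k))))).

Lemma bounded_undefined_by m q : bounded m.+1 (undefined_by m q).
Proof.
rewrite /undefined_by; set k := code q + m.+1.
rewrite /= andbT bounded_iter_all.
have k0 : 0 < k by rewrite /k addnS.
have qk : bounded (k + m.+1) q.
  apply: bounded_mono (bounded_code q); apply: leq_trans (leq_addr _ _).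
  by rewrite /k addnS ltnS leq_addr.
have : forall i, i \in iota 0 m -> i < m by move=> i; rewrite mem_iota.
elim: (iota 0 m) => [_|i s IH sm] /=.
  by rewrite !qk addn_gt0 k0 -{1 3}[k]addn0 ltn_add2l.
rewrite IH ?andbT => [|j js]; last by apply: sm; rewrite inE js orbT.
have im := sm i (mem_head _ _).
by rewrite ltn_add2l ltnS im andbT (leq_trans (n := m.+1)) // leq_addl.
Qed.

Lemma code_iter_all k (p : fo_formula) :
  code (iter k (@All void) p) = iter k (cantor_pair 4) (code p).
Proof. by elim: k => //= k ->. Qed.

Lemma recursive_params_imp k (kf : k.-tuple nat -> nat) p s :
  recursive kf -> recursive (fun v => code (p v)) ->
  recursive (fun v => code (params_imp (kf v) s (p v))).
Proof.
move=> Rk Rp; elim: s => //= i s IH.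
by recur.
Qed.

Lemma recursive_undefined_by m :
  recursive_sequence (fun n => undefined_by m (formula_value n)).
Proof.
have Rq := recursive_formula_value.
have Riter : recursive2 (fun n x => iter n (cantor_pair 4) x).
  have : @recursive 3 (fun v => cantor_pair 4 (thead [tuple of behead v])) by recur.
  move/(recursive_prim2 (f := id) (h := fun _ r _ => cantor_pair 4 r) (recursive_arg1 0)).
  by apply: rec_ext => v; elim: (thead v) => //= n ->.
pose kf (v : 1.-tuple nat) := code (formula_value (thead v)) + m.+1.
have Rk : recursive kf by rewrite /kf; recur.
have Rp : @recursive 1 (fun v => code (params_imp (kf v) (iota 0 m)
    (Iff (formula_value (thead v)) (Eq (Var 0) (Var (kf v)))))).
  by apply: recursive_params_imp => //=; recur.
have := recursive_comp2 recursive_pair (recursive_const 1 3) (recursive_comp2 recursive_pair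
  (recursive_comp2 Riter Rk Rp) (recursive_const 1 (cantor_pair 2 0))).
by apply: rec_ext => v; rewrite /undefined_by /= code_iter_all.
Qed.

Section NotSaturated.
Variable M : structure.
Implicit Types (a us : seq M) (u v : nat -> M).
Local Notation nth0 := (nth (s_zero M)).

Lemma sat_iter_AllP k (p : fo_formula) u :
  fo_sat u (iter k (@All void) p) <->
  forall us, size us = k -> fo_sat (cat_env us u) p.
Proof.
elim: k u => [|k IH] u.
  by split=> [H [|]//|/(_ [::])]; apply.
split=> [H us|H].
  (* The outermost quantifier binds the last entry of the list. *)
  case/lastP: us => // us x; rewrite size_rcons => -[sk].
  by rewrite -cats1 cat_env_cat; move: (H x) => /IH /(_ _ sk).
rewrite iterS /fo_sat /= => x; apply/IH => us sk.
have := H (rcons us x); rewrite size_rcons sk => /(_ erefl).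
by rewrite -cats1 cat_env_cat.
Qed.

Lemma sat_params_imp k s p v :
  fo_sat v (params_imp k s p) <->
  ((forall i, i \in s -> v i.+1 = v (k + i.+1)) -> fo_sat v p).
Proof.
elim: s => [|i s IH]; first by split=> // H; apply: H.
split=> [H vs|H vi].
  have vi := vs i (mem_head _ _).
  by apply: (IH.1 (H vi)) => j js; apply: vs; rewrite inE js orbT.
by apply/IH => vs; apply: H => j; rewrite inE => /orP[/eqP->//|/vs].
Qed.

Lemma sat_iff v (p q : fo_formula) : fo_sat v (Iff p q) <-> (fo_sat v p <-> fo_sat v q).
Proof.
rewrite /fo_sat /=; split=> [H|[H1 H2] H3]; last exact: H3.
by split=> [Hp|Hq]; apply: contrapT => n; apply: H => H1 H2; apply: n; auto.
Qed.

Lemma cat_env_nth us v i : i < size us -> cat_env us v i = nth0 us i.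
Proof. by elim: us i => [|b us IH] [|i] //=; apply: IH. Qed.

(** The list [us] interprets the variables of [q]: entry 0 is the candidate value, the next [size a]
    entries are forced to be [a], and the others range freely because [q] may have further
    variables. *)
Lemma sat_undefined_by a q x :
  fo_sat (tuple_env x a) (undefined_by (size a) q) <->
  ~ forall us, size us = code q + (size a).+1 ->
      (forall i, i < size a -> nth0 us i.+1 = nth0 a i) ->
      (fo_sat (nth0 us) q <-> nth0 us 0 = x).
Proof.
set k := code q + _.
suff e : fo_sat (tuple_env x a) (iter k (@All void) (params_imp k (iota 0 (size a))
    (Iff q (Eq (Var 0) (Var k))))) <-> forall us, size us = k ->
      (forall i, i < size a -> nth0 us i.+1 = nth0 a i) ->
      (fo_sat (nth0 us) q <-> nth0 us 0 = x).
  by rewrite /undefined_by -/k; split=> [H1 H2|H1 H2]; apply: H1; apply/e.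
have key us : size us = k ->
    (fo_sat (cat_env us (tuple_env x a)) (params_imp k (iota 0 (size a))
      (Iff q (Eq (Var 0) (Var k)))) <->
    ((forall i, i < size a -> nth0 us i.+1 = nth0 a i) ->
      (fo_sat (nth0 us) q <-> nth0 us 0 = x))).
  move=> sk; set v := cat_env _ _.
  have vlt i : i < k -> v i = nth0 us i by rewrite -sk; apply: cat_env_nth.
  have vge i : v (k + i) = tuple_env x a i by rewrite -sk addnC; apply: cat_env_ge.
  have <- : fo_sat v q = fo_sat (nth0 us) q.
    apply: sat_bounded (bounded_code q) _ => i iq; apply: vlt.
    by apply: leq_trans iq _; rewrite /k addnS ltnS leq_addr.
  have vk : v k = x by rewrite -[k]addn0 vge.
  have <- : v 0 = nth0 us 0 by apply: vlt; rewrite /k addnS.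
  have hyp : (forall i, i \in iota 0 (size a) -> v i.+1 = v (k + i.+1)) <->
             (forall i, i < size a -> nth0 us i.+1 = nth0 a i).
    have vi i : i < size a -> v i.+1 = nth0 us i.+1.
      by move=> ia; apply: vlt; rewrite /k addnS ltnS (leq_trans ia) ?leq_addl.
    split=> H i; first by move=> ia; rewrite -vi // H ?mem_iota // vge.
    by rewrite mem_iota => ia; rewrite vi // H // vge.
  rewrite sat_params_imp sat_iff hyp.
  have -> : fo_sat v (Eq (Var 0) (Var k)) = (v 0 = x) by rewrite /fo_sat /= vk.
  by [].
by rewrite sat_iter_AllP; split=> H us sk; apply/key/H.
Qed.

(** A formula defines at most one element from the generators, so each member of the type excludes
    at most one numeral, and large numerals realize finite parts. An element realizing the whole
    type would not be definable from the generators. *)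
Theorem finitely_generated_not_saturated :
  injective (num M) -> finitely_generated M -> ~ recursively_saturated M.
Proof.
move=> inj [a gen_a] /(_ a (fun n => undefined_by (size a) (formula_value n))).
move=> /(_ (fun n => bounded_undefined_by _ _) (recursive_undefined_by _)) [s|x Hx].
- suff [m Hm] : exists m, forall j n, m <= j -> n \in s ->
      fo_sat (tuple_env (num M j) a) (undefined_by (size a) (formula_value n)).
    by exists (num M m) => n; apply: Hm.
  elim: s => [|n s [m Hm]]; first by exists 0.
  have [[i ni]|Hn] := pselect (exists i,
      ~ fo_sat (tuple_env (num M i) a) (undefined_by (size a) (formula_value n))); last first.
    exists m => j n' mj; rewrite inE => /orP[/eqP->|]; last exact: Hm.
    by apply: contrapT => nj; apply: Hn; exists j.
  exists (maxn m i.+1) => j n'; rewrite geq_max => /andP[mj ij].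
  rewrite inE => /orP[/eqP->|]; last exact: Hm.
  apply: contrapT => nj; suff ji : j = i by rewrite ji ltnn in ij.
  apply: inj; move: ni nj; rewrite !sat_undefined_by => /contrapT Hi /contrapT Hj.
  (* If the formula defined both numerals, it would hold with [num M j] at variable 0, which forces
     this element to equal [num M i]. The zeros only bring the list to its required length. *)
  pose us := num M j :: a ++ nseq (code (formula_value n)) (s_zero M).
  have sus : size us = code (formula_value n) + (size a).+1.
    by rewrite /us /= size_cat size_nseq addnS addnC.
  have aus i' : i' < size a -> nth0 us i'.+1 = nth0 a i' by rewrite /us /= nth_cat => ->.
  by apply: (Hi us sus aus).1; apply: (Hj us sus aus).2.
- have [p [pa px]] := gen_a x; have [n np] := formula_value_surj p.
  have := Hx n; rewrite sat_undefined_by np; apply => us sus aus.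
  rewrite -px; suff -> : fo_sat (nth0 us) p = fo_sat (tuple_env (nth0 us 0) a) p by [].
  by apply: sat_bounded pa _ => -[|i] //=; rewrite ltnS => /aus.
Qed.

End NotSaturated.

(** * The definable closure as an elementary submodel *)

Lemma dfn1_env (N : structure) (SV : Type) (A : N -> Prop) (V : SV -> N -> Prop)
    (p : formula SV) (v : nat -> N) :
  (forall i, dfn1 A (V i)) -> (forall i, dcl A (v i)) ->
  dfn1 A (fun x => sat V (scons x v) p).
Proof.
move=> dV dv; have [k pk] := bounded_ex p.
have dus : all_in (dcl A) (mkseq v k).
  by rewrite /mkseq; elim: (iota 0 k) => //= i s IH; split.
have := dfn1_sat (V := fun i y _ => V i y) p dV dus.
apply: dfn_ext => u; rewrite -propeqE; apply: sat_bounded pk _ => -[|n] //= nk.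
by rewrite (cat_env_nth _) ?size_mkseq 1?ltnW // nth_mkseq // ltnW.
Qed.

Section Hull.
Variables (N : structure) (A : N -> Prop).
Hypothesis HPA : forall p, PA p -> forall v : nat -> N, fo_sat v p.

Definition hull : structure :=
  @Structure {a : N | dcl A a}
    (exist _ (s_zero N) (dfn_fo A (Eq (Var 0) Zero)))
    (exist _ (s_one N) (dfn_fo A (Eq (Var 0) One)))
    (fun a b => exist _ _ (dcl_term2 (f := Add) (fun _ _ _ => erefl)
                             (proj2_sig a) (proj2_sig b)))
    (fun a b => exist _ _ (dcl_term2 (f := Mul) (fun _ _ _ => erefl)
                             (proj2_sig a) (proj2_sig b)))
    (fun a b => s_lt (proj1_sig a) (proj1_sig b)).

Definition hull_val (a : hull) : N := proj1_sig a.

Lemma hull_val_inj : injective hull_val.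
Proof. by move=> [a da] [b db] /= ab; apply: eq_exist. Qed.

Lemma hull_num k : hull_val (num hull k) = num N k.
Proof.
by elim: k => // k IH; rewrite -[RHS]/(s_add (num N k) (s_one N)) -IH.
Qed.

Lemma hull_standard (a : hull) : standard a <-> standard (hull_val a).
Proof.
split=> -[k ak]; exists k; first by rewrite ak; apply: hull_num.
by apply: hull_val_inj; rewrite ak; apply/esym/hull_num.
Qed.

Lemma hull_eval (v : nat -> hull) t :
  hull_val (eval v t) = eval (fun n => hull_val (v n)) t.
Proof. by elim: t => //= t IHt u IHu; rewrite -IHt -IHu. Qed.

(* Tarski-Vaught: a definable nonempty set has a definable least element. *)
Lemma hull_sat (SV : Type) (V : SV -> N -> Prop) (p : formula SV) (v : nat -> hull) :
  (forall i, dfn1 A (V i)) ->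
  sat (fun i a => V i (hull_val a)) v p <-> sat V (fun n => hull_val (v n)) p.
Proof.
move=> dV; elim: p v => //= [t u|t u|t X|p IHp q IHq|p IHp] v.
- rewrite -!hull_eval; split=> [->//|]; exact: hull_val_inj.
- by rewrite -!hull_eval.
- by rewrite -hull_eval.
- by rewrite IHp IHq.
have scE (a : hull) : scons (hull_val a) (fun n => hull_val (v n)) =
    (fun n => hull_val (scons a v n)) by apply/funext; case.
split=> [H x|H a]; last by apply/IHp; rewrite -scE; apply: H.
apply: contrapT => nx.
have dY : dfn1 A (fun x => ~ sat V (scons x (fun n => hull_val (v n))) p).
  apply: dfn_not; apply: dfn1_env => // i; exact: proj2_sig (v i).
have [m lm] := least_exists HPA dY nx.
pose a : hull := exist _ m (dcl_least HPA dY lm).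
by apply: lm.1; rewrite -[m]/(hull_val a) scE; apply/IHp/H.
Qed.

Lemma hull_fo_sat (p : fo_formula) (v : nat -> hull) :
  fo_sat v p <-> fo_sat (fun n => hull_val (v n)) p.
Proof.
rewrite /fo_sat -hull_sat; last by case.
by have -> : (fun X : void => match X return hull -> Prop with end) =
  (fun (X : void) a => match X return N -> Prop with end (hull_val a))
  by apply/funext; case.
Qed.

(** Elementarity carries a defining formula between the hull and [N], and parameters from the hull
    are themselves definable over [A]. *)
Lemma hull_Def (X : hull -> Prop) :
  Def X <-> exists Y, dfn1 A Y /\ forall a, X a <-> Y (hull_val a).
Proof.
split=> [[p [v Xp]]|[Y [dY XY]]].
  exists (fun y => fo_sat (scons y (fun n => hull_val (v n))) p); split.
    apply: dfn1_env; [by case|move=> i; exact: proj2_sig (v i)].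
  move=> a; rewrite Xp hull_fo_sat.
  by have -> // : (fun n => hull_val (scons a v n)) =
    scons (hull_val a) (fun n => hull_val (v n)) by apply/funext; case.
have [p [us [Aus Yp]]] := dY.
have [vs vsE] : exists vs : seq hull, us = map hull_val vs.
  elim: us Aus {Yp} => [|b us IH] /=; first by exists [::].
  case=> /dcl_in db /IH[vs ->].
  by exists (exist _ b db :: vs).
have := @dfn1_Def hull (fun=> True) X; apply; exists p, vs; split.
  by elim: (vs).
move=> v; rewrite XY (Yp (fun n => hull_val (v n))) hull_fo_sat.
suff -> : (fun n => hull_val (cat_env vs v n)) =
  cat_env us (fun n => hull_val (v n)) by [].
rewrite vsE; apply/funext => n; elim: vs n {vsE} => //= b vs IH [|n] //=.
Qed.

End Hull.

Section TwoGenerators.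
Variables (N : structure) (w g : N).
Hypothesis HPA : forall p, PA p -> forall v : nat -> N, fo_sat v p.

(** All variables from 2 on read [w], so any formula whatever names a set, and there are only
    countably many names. *)
Definition named (x : N) (p : fo_formula) (y : N) : Prop :=
  fo_sat (scons y (scons x (fun _ => w))) p.

Lemma dfn1_named x p : dfn1 (gen w x) (named x p).
Proof.
apply: dfn1_env => [[]|[|i]]; first by apply: dcl_in; left.
by apply: dcl_in; right.
Qed.

Lemma dfn1_namedP Y : dfn1 (gen w g) Y ->
  exists p, forall y, Y y <-> named g p y.
Proof.
move=> [p [us [gus Yp]]]; pose e y := scons y (scons g (fun _ => w)).
(* Each parameter is [g] or [w], already present in [e y] at index 1 or 2, so a renaming of
   variables replaces the parameter list. *)
have [r rE] : exists r : nat -> nat, forall y n, cat_env us (e y) n = e y (r n).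
  elim: us gus {Yp} => [|a us IH] /=; first by exists id.
  case=> ga /IH[r rE]; case: ga => ->.
    by exists (scons 1 r) => y -[|n] //=.
  by exists (scons 2 r) => y -[|n] //=.
exists (subst (fun n => Var (r n)) p) => y; rewrite (Yp (e y)) /named fo_sat_rename.
by have -> : cat_env us (e y) = fun n => e y (r n) by apply/funext.
Qed.

Local Notation M := (hull (gen w g)).

Lemma hull_named (a : M) : exists p, forall y, named g p y <-> y = hull_val a.
Proof.
have [p pE] := dfn1_namedP (Y := fun y => y = hull_val a) (proj2_sig a).
by exists p => y; rewrite -pE.
Qed.

Lemma hull_countable : countable_structure M.
Proof.
have /choice[p pE] := hull_named; exists (fun a => pickle (p a)) => a b.
move=> /(pcan_inj pickleK) pab; apply: hull_val_inj.
by apply/(pE b); rewrite -pab; apply/(pE a).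
Qed.

Lemma hull_finitely_generated : finitely_generated M.
Proof.
have dg : dcl (gen w g) g by apply: dcl_in; left.
have dw : dcl (gen w g) w by apply: dcl_in; right.
exists [:: exist _ g dg : M; exist _ w dw : M] => b; have [p pE] := hull_named b.
(* The variables from 2 on all mean [w] and are merged into variable 2, which meets the bound 3 for
   two generators. *)
exists (subst (fun n => Var (minn n 2)) p); split.
  have [k pk] := bounded_ex p; apply: bounded_subst pk _ => n _ /=.
  by rewrite ltnS geq_minr.
move=> x; rewrite fo_sat_rename hull_fo_sat //.
have -> : (fun n => hull_val (tuple_env x [:: exist _ g dg : M; exist _ w dw : M] (minn n 2)))
    = scons (hull_val x) (scons g (fun _ => w)).
  by apply/funext => -[|[|[|n]]].
by rewrite -/(named g p _) pE; split=> [/hull_val_inj|->].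
Qed.

End TwoGenerators.

(** * Eliminating parameters from definitions of the standard cut *)

Lemma sat_set_vars (p : formula nat) : exists s, forall (M : structure)
    (V V' : nat -> M -> Prop), (forall i, i < s -> V i = V' i) ->
  forall v, sat V v p = sat V' v p.
Proof.
elim: p => [t u|t u|t X||p [s IHp] q [s' IHq]|p [s IHp]].
- by exists 0.
- by exists 0.
- by exists X.+1 => M V V' VV' v /=; rewrite VV'.
- by exists 0.
- exists (maxn s s') => M V V' VV' v /=; rewrite (IHp M V V') ?(IHq M V V') //.
    by move=> i si; apply: VV'; rewrite leq_max si orbT.
  by move=> i si; apply: VV'; rewrite leq_max si.
- exists s => M V V' VV' v /=; rewrite propeqE; split=> H x; have := H x;
  by rewrite (IHp M V V').
Qed.

(* Trades the number parameters at the variables [1, ..., k] for the set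
   parameters at the set variables [s, ..., s + k - 1], which should be the
   corresponding singletons. *)
Fixpoint elim_params (k s : nat) (p : formula nat) : formula nat :=
  if k is k'.+1 then
    elim_params k' s.+1 (All (Imp (Mem (Var 0) s)
      (subst (scons (Var 1) (scons (Var 0) (fun n => Var n.+2))) p)))
  else p.

Lemma sat_elim_params (M : structure) (V : nat -> M -> Prop) us s p x v :
  (forall i, i < size us -> forall y, V (s + i) y <-> y = nth (s_zero M) us i) ->
  sat V (scons x (cat_env us v)) p <->
  sat V (scons x v) (elim_params (size us) s p).
Proof.
elim: us s p => //= a us IH s p HV; rewrite -IH /=; last first.
  by move=> i ius y; rewrite addSnnS; apply: (HV i.+1).
have Va y : V s y <-> y = a by have := HV 0 isT y; rewrite addn0.
have e : sat V (scons a (scons x (cat_env us v)))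
    (subst (scons (Var 1) (scons (Var 0) (fun n => Var n.+2))) p) =
  sat V (scons x (scons a (cat_env us v))) p.
  by rewrite sat_subst; congr sat; apply/funext => -[|[|n]].
rewrite -e; split=> [H y /Va -> //|H]; exact/H/Va.
Qed.

Section NotDelta11.
Variables (N : structure) (w : N).

(* The index [i] codes a matrix and names of set parameters, [n] the name of a
   set: the relation says that the set refutes the matrix at [z]. *)
Definition refutes (i n : nat) (z x : N) : Prop :=
  let: (p, qs) := nth_of (Bot : formula nat, [::] : seq fo_formula) i in
  ~ sat (fun j => named w x (scons (nth_of Bot n) (nth Bot qs) j))
        (scons z (fun _ => w)) p.

Lemma dfn_refutes i n : dfn (eq w) (fun v => refutes i n (v 0) (v 1)).
Proof.
rewrite /refutes; case: (nth_of _ i) => p qs; apply: dfn_not.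
have dV (j : nat) : dfn (eq w)
    (fun v => named w (v 1) (scons (nth_of Bot n) (nth Bot qs) j) (v 0)).
  have := dfn_param (a := w) erefl (dfn_term
    (scons (Var 1) (scons (Var 2) (fun _ => Var 0)))
    (dfn_fo (eq w) (scons (nth_of Bot n) (nth Bot qs) j))).
  apply: dfn_ext => v; rewrite /named.
  suff -> : (fun k => eval (scons w v) (scons (Var 1) (scons (Var 2) (fun _ => Var 0)) k))
    = scons (v 0) (scons (v 1) (fun _ => w)) by [].
  by apply/funext => -[|[|k]].
have := dfn_param (a := w) erefl (dfn_term
  (scons (Var 2) (scons (Var 1) (fun _ => Var 0))) (dfn_sat (V := fun j y x =>
    named w x (scons (nth_of Bot n) (nth Bot qs) j) y) p dV)).
apply: dfn_ext => v /=.
suff -> : (fun k => eval (scons w v) (scons (Var 1) (fun _ => Var 0) k)) =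
  scons (v 0) (fun _ => w) by [].
by apply/funext => -[|k].
Qed.

Hypothesis HPA : forall p, PA p -> forall v : nat -> N, fo_sat v p.
Variable g : N.
Hypothesis generic : forall i,
  (exists n k, refutes i n (num N k) g) \/
  (exists e, [/\ dcl (gen w g) e, ~ standard e & forall n, ~ refutes i n e g]).

Local Notation M := (hull (gen w g)).

Lemma hull_Def_named (X : M -> Prop) :
  Def X -> exists q, X = fun a => named w g q (hull_val a).
Proof.
move=> /hull_Def[//|Y [dY XY]]; have [q qE] := dfn1_namedP dY.
by exists q; apply/funext => a; rewrite propeqE XY qE.
Qed.

(** A point lies outside a Pi^1_1 set when some named set refutes the matrix there. For the index of
    the given definition, [generic] yields either a refuted standard number or an unrefuted
    nonstandard one. *)
Theorem standard_not_pi11 : ~ pi11 (@Def M) (@standard M).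
Proof.
move=> [p [v [P [DP Pp]]]].
have [s sP] := sat_set_vars p; have [k pk] := bounded_ex p.
(* Beyond the set variables of [p], the singletons of the number parameters are appended, so that
   every parameter becomes a named set. In [p'] they start at [s.+1], since set variable 0 is the
   quantified set. *)
pose P' i := if i < s then P i else fun y => y = v (i - s).
have DP' i : Def (P' i).
  rewrite /P'; case: ifP => // _; apply: (@dfn1_Def _ (fun a => a = v (i - s))).
  exact: dcl_in.
have dw : dcl (gen w g) w by apply: dcl_in; right.
pose wM : M := exist _ w dw; pose p' := elim_params k s.+1 p.
have {sP pk} pp' X x : sat (scons X P) (scons x v) p <->
    sat (scons X P') (scons x (fun _ => wM)) p'.
  rewrite (sP _ _ (scons X P')); last by move=> [|i] //= si; rewrite /P' ltnW.
  rewrite (sat_bounded (v' := scons x (cat_env (mkseq v k) (fun _ => wM))) _ pk).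
    rewrite /p' -[k in elim_params k](size_mkseq v k); apply: sat_elim_params => i.
    rewrite size_mkseq => ik y; rewrite nth_mkseq //= /P'.
    by rewrite ltnNge leq_addr /= addKn.
  move=> [|i] //= ik.
  by rewrite cat_env_nth ?size_mkseq 1?ltnW // nth_mkseq // ltnW.
have /choice[q qE] := fun i => hull_Def_named (DP' i).
(* Only finitely many set variables occur in [p'], so a finite list of names, hence a single index
   [i], captures the definition. *)
have [s' s'P] := sat_set_vars p'; pose qs := mkseq q s'.
have [i iE] := nth_of_surj (Bot : formula nat, [::] : seq fo_formula) (p', qs).
have key n (x : M) : ~ refutes i n (hull_val x) g <->
    sat (scons (fun a => named w g (nth_of Bot n) (hull_val a)) P)
        (scons x v) p.
  rewrite pp' /refutes iE.
  rewrite (s'P _ _ (fun j a => named w g (scons (nth_of Bot n) (nth Bot qs) j) (hull_val a)));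
    last first.
    by move=> [|j] //= js; rewrite qE nth_mkseq // ltnW.
  rewrite (hull_sat HPA (V := fun j =>
    named w g (scons (nth_of Bot n) (nth Bot qs) j))) => [|j]; last exact: dfn1_named.
  have -> : (fun m => hull_val (scons x (fun _ => wM) m)) =
    scons (hull_val x) (fun _ => w) by apply/funext; case.
  by split=> [/contrapT|H].
have [[n [j ref]]|[e [de e_nonstd nref]]] := generic i.
  have : standard (num M j) by exists j.
  move=> /Pp /(_ (fun a => named w g (nth_of Bot n) (hull_val a))) H.
  have /key : sat (scons (fun a => named w g (nth_of Bot n) (hull_val a)) P)
      (scons (num M j) v) p.
    apply: H; apply/hull_Def => //.
    by exists (named w g (nth_of Bot n)); split=> //; apply: dfn1_named.
  by apply; rewrite hull_num.
pose eM : M := exist _ e de; apply: e_nonstd.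
apply/(hull_standard eM); apply/Pp => X /hull_Def_named[r ->].
have [n <-] := nth_of_surj Bot r; exact/key/nref.
Qed.

End NotDelta11.

Theorem theorem3 (T : theory) (hT : completion_of_PA T) :
  exists M : structure,
    model_of M T /\
    countable_structure M /\
    nonstandard M /\
    ~ recursively_saturated M /\
    ~ delta11 (@Def M) (@standard M) /\
    finitely_generated M.
Proof.
have [Ts TPA Tc _] := hT.
have PAs p : PA p -> sentence p by case.
have [K KT] := completeness Ts Tc; have [N [Nsat NK]] := saturated_extension K.
have NT p : sentence p -> proves T p -> forall v : nat -> N, fo_sat v p.
  by move=> sp Tp; apply: NK => // v; apply: KT.
have HPA p : PA p -> forall v : nat -> N, fo_sat v p.
  by move=> Pp; apply: NT; [apply: PAs|apply: TPA].
(* A nonstandard [w] realizes the type of differing from every numeral; [num N n] realizes its first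
   [n] requirements. *)
have [n|n|w Hw] := Nsat (fun n x => x <> num N n).
- apply: (@dfn1_Def _ (fun=> True)); apply: dfn_not; exact: dcl_num.
- by exists (num N n) => i ni /(num_inj HPA) nE; rewrite nE ltnn in ni.
have w_nonstd : ~ standard w by case=> k; apply: Hw.
have [g Hg] := generic_exists HPA Nsat w_nonstd (@dfn_refutes N w).
have fg := hull_finitely_generated w g HPA.
exists (hull (gen w g)); split.
  by move=> p Tp v; apply/hull_fo_sat => //; apply: NT; [apply: Ts|apply: proves_axiom].
split; first exact: hull_countable.
split.
  have dw : dcl (gen w g) w by apply: dcl_in; right.
  by exists (exist _ w dw : hull (gen w g)) => /hull_standard.
split; last by split=> // -[_]; apply: standard_not_pi11.
apply: finitely_generated_not_saturated fg => i j ij; apply: (num_inj HPA).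
by rewrite -!(hull_num (gen w g)) ij.
Qed.
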